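(* Let $\Delta$ and $m_2$ be positive integers. Then there exists an integer $n_2 = n_2(\Delta, m_2)$ such that the following holds for every $n \geq n_2$ and for every tree $T = (V,E)$ such that $|V| = n$ and maximum degree $\Delta(T) \leq \Delta$. If $T$ does not admit a bare path of length $m_2$, then Maker has a strategy to win the tree embedding game $(E(K_n), \mathcal{T}_n)$ within $n+1$ moves (of Maker).
   Context: Maker-Breaker game: Let $X$ be a finite set (the board) and $\mathcal{F} \subseteq 2^X$ a family of winning sets. In the Maker-Breaker game $(X, \mathcal{F})$, Maker and Breaker alternately claim one previously unclaimed element of $X$ per move, with Breaker going first. Maker wins as soon as she has claimed all elements of some winning set. ''Maker has a strategy to win within $k$ moves'' means that she has a strategy that, against any strategy of Breaker, ensures that she has fully claimed a winning set after making at most $k$ moves of her own. Tree embedding game: For a tree $T$ on $n$ vertices, the tree embedding game $(E(K_n), \mathcal{T}_n)$ is the Maker-Breaker game whose board is the edge set of the complete graph $K_n$ and whose (minimal) winning sets are the edge sets of all labeled copies of $T$ in $K_n$; so Maker wins as soon as the graph formed by her edges contains a copy of $T$. Bare path: A path of a tree $T$ is called bare if all of its interior vertices (i.e. vertices other than its two endpoints) have degree $2$ in $T$. The length of a path is its number of edges. *)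

(* Defs.v *)
From mathcomp Require Import all_boot.

Set Implicit Arguments.
Unset Strict Implicit.
Unset Printing Implicit Defensive.

(** Maker-Breaker games on a board contained in a finite type [X]. *)

(** The moves of each player, most recent first.  As the players alternate and
    Breaker starts, a position records the whole history of the play. *)
Record position (X : Type) := Position {
  breaker_moves : seq X;
  maker_moves : seq X
}.

Definition start (X : Type) : position X := Position [::] [::].

Definition free (X : finType) (board : {set X}) (p : position X) : {set X} :=
  [set x in board | (x \notin breaker_moves p) && (x \notin maker_moves p)].

Definition strategy (X : Type) := position X -> X.

Definition legal (X : finType) (board : {set X}) (s : strategy X) : Prop :=
  forall p, free board p != set0 -> s p \in free board p.

(** On a full board the game is over: the position no longer changes. *)
Definition breaker_turn (X : finType) (board : {set X}) (s : strategy X)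
    (p : position X) : position X :=
  if free board p == set0 then p
  else Position (s p :: breaker_moves p) (maker_moves p).

Definition maker_turn (X : finType) (board : {set X}) (s : strategy X)
    (p : position X) : position X :=
  if free board p == set0 then p
  else Position (breaker_moves p) (s p :: maker_moves p).

(** The position after [k] rounds, hence after at most [k] moves of Maker. *)
Definition play (X : finType) (board : {set X}) (sM sB : strategy X)
    (k : nat) : position X :=
  iter k (fun p => maker_turn board sM (breaker_turn board sB p)) (start X).

Definition maker_has_won (X : finType) (F : {set {set X}})
    (p : position X) : Prop :=
  exists2 W : {set X}, W \in F & W \subset maker_moves p.

Definition maker_wins_within (X : finType) (board : {set X})
    (F : {set {set X}}) (k : nat) : Prop :=
  exists2 sM : strategy X, legal board sM &
    forall sB : strategy X, legal board sB ->
      exists2 j : nat, j <= k & maker_has_won F (play board sM sB j).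

(** Finite simple graphs, given by their adjacency relation. *)

Definition simple_graph (V : finType) (e : rel V) : Prop :=
  symmetric e /\ irreflexive e.

Definition connected_graph (V : finType) (e : rel V) : Prop :=
  0 < #|V| /\ forall x y, connect e x y.

(** For a symmetric [e], any edge gives a [ucycle] of size 2, which is not a
    cycle of the graph. *)
Definition acyclic (V : finType) (e : rel V) : Prop :=
  forall c : seq V, 2 < size c -> ~ ucycle e c.

Definition is_tree (V : finType) (e : rel V) : Prop :=
  [/\ simple_graph e, connected_graph e & acyclic e].

Definition degree (V : finType) (e : rel V) (x : V) : nat := #|[set y | e x y]|.

Definition max_degree (V : finType) (e : rel V) : nat := \max_(x : V) degree e x.

(** The path with vertex sequence [x :: p], whose length is [size p] and whose
    interior vertices are those of [behead (belast x p)]. *)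
Definition bare_path (V : finType) (e : rel V) (x : V) (p : seq V) : Prop :=
  [/\ path e x p, uniq (x :: p) &
      forall y, y \in behead (belast x p) -> degree e y = 2].

Definition has_bare_path (V : finType) (e : rel V) (m : nat) : Prop :=
  exists (x : V) (p : seq V), bare_path e x p /\ size p = m.

(** The tree embedding game; an edge of [K_n] is a 2-element set of vertices. *)

Definition complete_edges (n : nat) : {set {set 'I_n}} :=
  [set a : {set 'I_n} | #|a| == 2].

Definition copy_edges (V : finType) (e : rel V) (n : nat) (f : V -> 'I_n) :
    {set {set 'I_n}} :=
  [set [set f u.1; f u.2] | u : V * V & e u.1 u.2].

Definition tree_copies (V : finType) (e : rel V) (n : nat) :
    {set {set {set 'I_n}}} :=
  [set copy_edges e f | f : {ffun V -> 'I_n} & injectiveb f].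

(* Main.v *)
Require Import Defs.
From mathcomp Require Import all_boot.
From mathcomp Require Import zify.

Set Implicit Arguments.
Unset Strict Implicit.
Unset Printing Implicit Defensive.

(** A tree of bounded degree without a long bare path has linearly many leaves,
    and even linearly many leaves with pairwise distinct parents
    ([card_leaves]).  Fix such a set [leaves].  Maker embeds the tree vertex by
    vertex from a root, one edge per move, and keeps the reserved leaves for the
    end.  Then what is left is to match the unused vertices of K_n with the
    parents of the missing leaves, and Maker loses no move before the last pair.
    Breaker may hold the edge of this last pair; Maker exchanges the pair with
    two embedded leaves: two extra edges create two ways of finishing, of
    which Breaker can block only one ([last_vertex]).  This costs n - 2 + 3 moves.

    Two things can go wrong.  First, Breaker can concentrate on a vertex of K_n.
    A vertex is alive if it is unused, or if it is the image of a vertex with a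
    child still to be embedded; only the Breaker-degrees of alive vertices
    matter.  Fix a small linear threshold [tau].  A vertex of Breaker-degree at
    least [tau] is heavy; there is a bounded number of them in the whole game,
    as Breaker plays at most about n edges.  As soon as an alive vertex is heavy
    Maker deals with it: if it is an image, a child of it is embedded; if it is
    unused, it is embedded itself.  Each heavy vertex asks for a bounded number
    of moves, so Breaker-degrees of alive vertices exceed [tau] by at most a
    constant ([controlled]).  To embed an unused heavy vertex one needs an open
    place which Breaker has not separated from it.  Late in the game there are
    many open places, again because of the absence of long bare paths
    ([card_opens], [many_opens]).  Early in the game there may be few of them,
    and Breaker can cut the heavy vertex v off from all.  Then Maker first
    claims an edge from v to a fresh vertex w, which can afterwards be attached
    at two different places; Breaker blocks at most one of them.  Two places
    exist since the embedding starts at an edge that splits the tree into two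
    large parts ([balanced_edge], [deep_slot], [two_deep_slots]).

    Second, Breaker can make the final matching impossible.  There Maker always
    kills a vertex of largest Breaker-degree in the remaining bipartite graph,
    together with a non-neighbour of largest degree ([kill_step]).  The maximum
    degree then never grows, and the number of Breaker's edges goes down faster
    than the number of remaining pairs, until Breaker's edges form a matching
    while many pairs are left ([matching_wins_capped_degree] and the lemmas
    before it).  From that moment on they form a matching after each of Maker's
    moves, so that a free edge exists until the last pair. *)

(** * A relaxed form of the game *)

Lemma setD_setU_neq0 (X : finType) (A B C : {set X}) :
  #|B| + #|C| < #|A| -> A :\: (B :|: C) != set0.
Proof.
move=> lt; rewrite -card_gt0 cardsD.
have := subset_leq_card (subsetIr A (B :|: C)).
have := (leq_card_setU B C).1; lia.
Qed.

Section Game.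
Variables (X : finType) (board : {set X}) (F : {set {set X}}).

(** Here Breaker may claim any edge, even one already claimed, and Maker may
    claim any edge that Breaker does not hold, even her own: no proof that an
    edge is new is then ever needed. *)
Fixpoint wins (k : nat) (B M : {set X}) : Prop :=
  (exists2 W, W \in F & W \subset M) \/
  if k is k'.+1 then
    forall b, b \in board -> exists m, [/\ m \in board, m \notin b |: B &
      wins k' (b |: B) (m |: M)]
  else False.

Lemma wins_won k (B M W : {set X}) : W \in F -> W \subset M -> wins k B M.
Proof. by case: k => [|k] WF WM; left; exists W. Qed.

(** The true game, in boolean form so that a strategy can pick a good move. *)
Fixpoint force (k : nat) (B M : {set X}) : bool :=
  [exists W in F, W \subset M] ||
  if k is k'.+1 then
    [forall b in board :\: (B :|: M),
      [exists m in board :\: ((b |: B) :|: M), force k' (b |: B) (m |: M)]]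
  else false.

(** Extra edges do not hurt Maker: when her relaxed move is an edge that she
    already has, she plays any free edge.  One exists as the board is large. *)
Lemma wins_force k (B M M' : {set X}) : wins k B M -> M \subset M' ->
  #|B| + #|M'| + 2 * k <= #|board| -> force k B M'.
Proof.
elim: k B M M' => [|k IH] B M M' Hw MM' sz.
  case: Hw => [[W WF WM]|//]; apply/orP; left.
  by apply/existsP; exists W; rewrite WF (subset_trans WM).
case: Hw => [[W WF WM]|H]; apply/orP; [left|right].
  by apply/existsP; exists W; rewrite WF (subset_trans WM).
apply/forallP => b; apply/implyP; rewrite !inE negb_or.
case/andP=> /andP[bB bM] bb; have [m [mb mB Hm]] := H b bb.
have szB : #|b |: B| <= #|B|.+1 by rewrite cardsU1; case: (_ \notin _).
case: (boolP (m \in M')) => mM; last first.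
  apply/existsP; exists m; rewrite inE inE negb_or mB mM mb /=.
  apply: IH Hm _ _; first by apply: setUS.
  have : #|m |: M'| <= #|M'|.+1 by rewrite cardsU1; case: (_ \notin _).
  lia.
have /set0Pn[m' m'in] : board :\: ((b |: B) :|: M') != set0.
  by apply: setD_setU_neq0; lia.
apply/existsP; exists m'; rewrite m'in /=.
apply: IH Hm _ _.
  by apply/subsetP => y /setU1P[->|/(subsetP MM')]; rewrite inE ?mM ?orbT // => ->; rewrite orbT.
have : #|m' |: M'| <= #|M'|.+1 by rewrite cardsU1; case: (_ \notin _).
lia.
Qed.

(** The number of rounds left is read off the history of the position. *)
Definition forcing_strategy (x0 : X) (K : nat) : strategy X := fun p =>
  let B := [set x in breaker_moves p] in let M := [set x in maker_moves p] in
  let good m := (m \in free board p) &&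
    force (K - (size (maker_moves p)).+1) B (m |: M) in
  if [pick m | good m] is Some m then m else odflt x0 [pick m in free board p].

Lemma free_setE (p : position X) : free board p =
  board :\: ([set x in breaker_moves p] :|: [set x in maker_moves p]).
Proof. by apply/setP => x; rewrite !inE negb_or andbC. Qed.

Lemma set_in_cons (x : X) s : [set y in x :: s] = x |: [set y in s].
Proof. by apply/setP => y; rewrite !inE. Qed.

(** The strategy keeps the position won for the remaining number of rounds, and
    the bound on [K] ensures that the board never fills up. *)
Lemma wins_maker_wins_within (x0 : X) K :
  2 * K <= #|board| -> wins K set0 set0 -> maker_wins_within board F K.
Proof.
move=> szb winK; exists (forcing_strategy x0 K).
  move=> p /set0Pn[y yf]; rewrite /forcing_strategy.
  case: pickP => [m /andP[]//|_]; case: pickP => [m //|/(_ y)].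
  by rewrite yf.
move=> sB legB.
have f0 : force K set0 set0 by apply: wins_force winK _ _; rewrite // !cards0.
suff inv j : j <= K -> (exists2 i, i <= j &
    maker_has_won F (play board (forcing_strategy x0 K) sB i)) \/
    let p := play board (forcing_strategy x0 K) sB j in
    [/\ size (breaker_moves p) = j, size (maker_moves p) = j &
     force (K - j) [set x in breaker_moves p] [set x in maker_moves p]].
  case: (inv K (leqnn K)) => [//|[_ _]].
  rewrite subnn /= orbF => /existsP[W /andP[WF WM]]; exists K => //.
  by exists W => //; apply: subset_trans WM _; apply/subsetP => x; rewrite inE.
elim: j => [_|j IH jK].
  right; split => //; rewrite subn0 /play /=.
  by rewrite (_ : [set x in [::]] = set0) //; apply/setP => x; rewrite !inE.
case: (IH (ltnW jK)) => [[i ij Hi]|]; first by left; exists i => //; apply: leqW.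
have -> : play board (forcing_strategy x0 K) sB j.+1 =
  maker_turn board (forcing_strategy x0 K)
    (breaker_turn board sB (play board (forcing_strategy x0 K) sB j)) by [].
set p := play _ _ _ j => /= -[sb sm].
rewrite -(subnSK jK) /= => /orP[/existsP[W /andP[WF WM]]|].
  left; exists j => //; exists W => //; rewrite -/p.
  by apply: subset_trans WM _; apply/subsetP => x; rewrite inE.
set B := [set x in breaker_moves p]; set M := [set x in maker_moves p].
have cB : #|B| <= j by rewrite -sb cardsE card_size.
have cM : #|M| <= j by rewrite -sm cardsE card_size.
move=> /forallP /(_ (sB p)).
have fp : free board p != set0 by rewrite free_setE -/B -/M; apply: setD_setU_neq0; lia.
have bfree := legB p fp; move: (bfree); rewrite free_setE => -> /=.
case/existsP=> m /andP[mfree fm]; right.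
rewrite /breaker_turn (negbTE fp).
set q := Position _ _.
have qB : [set x in breaker_moves q] = sB p |: B by rewrite set_in_cons.
have qf : m \in free board q by rewrite free_setE qB.
rewrite /maker_turn ifN; last by apply/set0Pn; exists m.
split => /=; rewrite ?sb ?sm //.
rewrite !set_in_cons -/B -/M /forcing_strategy qB sm.
case: pickP => [m' /andP[_]//|/(_ m)] /=.
by rewrite qf fm.
Qed.

End Game.

(** * Degrees in Breaker's graph *)

Section EdgeDegree.
Variable T : finType.
Implicit Types (B : {set {set T}}) (x y z : T).

Definition edeg B x := #|[set c in B | x \in c]|.

Lemma edeg_sub B B' x : B \subset B' -> edeg B x <= edeg B' x.
Proof.
move=> /subsetP sBB; apply/subset_leq_card/subsetP => c.
by rewrite !inE => /andP[/sBB-> ->].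
Qed.

Lemma edeg_add b B x : edeg (b |: B) x <= edeg B x + (x \in b).
Proof.
rewrite /edeg; case: (boolP (x \in b)) => xb; last first.
  rewrite addn0; apply/subset_leq_card/subsetP => c.
  by rewrite !inE => /andP[/orP[/eqP->|->//]]; rewrite (negbTE xb).
rewrite addn1; apply: (@leq_trans #|b |: [set c in B | x \in c]|).
  apply/subset_leq_card/subsetP => c; rewrite !inE.
  by case/andP=> /orP[->|-> ->]; rewrite ?orbT.
by rewrite cardsU1; case: (_ \notin _).
Qed.

Lemma edeg_add1 b B x : edeg (b |: B) x <= (edeg B x).+1.
Proof. by rewrite (leq_trans (edeg_add b B x)) // -addn1 leq_add2l leq_b1. Qed.

Lemma set2_injr x : injective (fun y => [set x; y]).
Proof.
move=> y y' /= E; have : y' \in [set x; y] by rewrite E !inE eqxx orbT.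
have : y \in [set x; y'] by rewrite -E !inE eqxx orbT.
by rewrite !inE => /orP[/eqP->|/eqP//]; rewrite orbb => /eqP.
Qed.

Lemma card_nbrs_le (U : finType) (g : U -> T) (Y : {set U}) B x :
  {in Y &, injective g} ->
  #|[set u in Y | [set x; g u] \in B]| <= edeg B x.
Proof.
move=> ginj; rewrite -(card_in_imset (f := fun u => [set x; g u])).
  apply/subset_leq_card/subsetP => _ /imsetP[y + ->].
  by rewrite !inE eqxx => /andP[_ ->].
move=> y y'; rewrite !inE => /andP[yY _] /andP[y'Y _] /set2_injr.
exact: ginj.
Qed.

Lemma sum_edeg B : (forall c, c \in B -> #|c| = 2) ->
  \sum_x edeg B x = 2 * #|B|.
Proof.
move=> B2; rewrite /edeg.
under eq_bigr => x _ do rewrite -sum1dep_card big_mkcondr /=.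
rewrite exchange_big /= mulnC -sum_nat_const; apply: eq_bigr => c cB.
by rewrite -big_mkcond /= sum1_card B2.
Qed.

(** Markov's inequality for the degrees, whose sum is twice the number of edges. *)
Lemma card_heavy B t : (forall c, c \in B -> #|c| = 2) ->
  t * #|[set x | t <= edeg B x]| <= 2 * #|B|.
Proof.
move=> /sum_edeg <-; rewrite mulnC -sum_nat_const.
rewrite [leqRHS](bigID (mem [set x | t <= edeg B x])) /=.
by apply: leq_trans (leq_addr _ _); apply: leq_sum => x; rewrite inE.
Qed.

Lemma exists_notin (U : finType) (A C : {set U}) :
  #|C| < #|A| -> exists2 x, x \in A & x \notin C.
Proof.
move=> lt; suff /subsetPn[x]: ~~ (A \subset C) by exists x.
by apply: contraL lt => /subset_leq_card; rewrite -leqNgt.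
Qed.

Lemma free_nbr (U : finType) (g : U -> T) (Y : {set U}) B x :
  {in Y &, injective g} -> edeg B x < #|Y| ->
  exists2 u, u \in Y & [set x; g u] \notin B.
Proof.
move=> ginj lt; have [|u uY] := @exists_notin U Y [set u in Y | [set x; g u] \in B].
  exact: leq_ltn_trans (card_nbrs_le B x ginj) lt.
by rewrite inE uY => H; exists u.
Qed.

End EdgeDegree.

(** * The matching game *)

Section Matching.
Variable T : finType.
Implicit Types (A P : {set T}) (B : {set {set T}}).

(** [A] and [P] have [k.+1] elements and [B] is Breaker's graph; each round
    Breaker adds an edge and Maker matches a pair that is not in Breaker's graph.
    The goal is to be left with a single pair, whatever its status. *)
Fixpoint matching_wins k A P B : Prop :=
  if k is k'.+1 then
    forall b, exists a p, [/\ a \in A, p \in P, [set a; p] \notin b |: B &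
      matching_wins k' (A :\ a) (P :\ p) (b |: B)]
  else True.

Definition cross A P B := B :&: [set [set a; p] | a in A, p in P].

Lemma crossC A P B : cross A P B = cross P A B.
Proof.
congr (_ :&: _); apply/setP => c.
by apply/imset2P/imset2P => -[x y xA yP ->]; exists y x => //; exact: setUC.
Qed.

Lemma crossP A P B c :
  reflect (c \in B /\ exists a p, [/\ a \in A, p \in P & c = [set a; p]])
          (c \in cross A P B).
Proof.
rewrite inE; apply: (iffP andP) => -[cB].
  by case/imset2P=> a p aA pP cE; split=> //; exists a, p.
by case=> a [p [aA pP cE]]; split=> //; apply/imset2P; exists a p.
Qed.

Lemma cross_add A P B b : cross A P (b |: B) \subset b |: cross A P B.
Proof.
apply/subsetP => c /crossP[/setU1P[->|cB] H]; apply/setU1P; [by left|right].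
by apply/crossP.
Qed.

Lemma cross_sub A P B b : cross A P B \subset cross A P (b |: B).
Proof. by apply: setSI; apply: subsetUr. Qed.

Lemma edeg_cross_out A P B z : z \notin A :|: P -> edeg (cross A P B) z = 0.
Proof.
move=> zAP; apply/eqP; rewrite cards_eq0; apply/eqP/setP => c; rewrite [RHS]inE inE.
apply: contraNF zAP => /andP[/crossP[_ [x [y [xA yP ->]]]]].
by rewrite !inE => /orP[] /eqP->; rewrite ?xA ?yP ?orbT.
Qed.

Lemma edeg_cross_le A P B z m :
  (forall z, z \in A :|: P -> edeg B z <= m) -> edeg (cross A P B) z <= m.
Proof.
move=> H; case: (boolP (z \in A :|: P)) => zAP; last by rewrite edeg_cross_out.
by apply: leq_trans (H z zAP); apply/edeg_sub/subsetIl.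
Qed.

Lemma cross_rem A P B a p : [disjoint A & P] -> a \in A -> p \in P ->
  cross (A :\ a) (P :\ p) B \subset
  [set c in cross A P B | (a \notin c) && (p \notin c)].
Proof.
move=> dis aA pP; apply/subsetP => c /crossP[cB [x [y [xA' yP' cE]]]].
move: xA' yP'; rewrite {c}cE in cB *; rewrite !inE => /andP[xa xA] /andP[yp yP]; rewrite !negb_or.
rewrite eq_sym xa (eq_sym p) (eq_sym p) yp (eq_sym a) andbT.
rewrite (contraTneq _ yP) => [|->]; last by rewrite (disjointFr dis).
rewrite (contraTneq _ xA) => [|->]; last by rewrite (disjointFl dis).
by rewrite ?andbT cB; apply/imset2P; exists x y.
Qed.

(** Used on both sides of the bipartite graph, this makes the largest degree at
    least the average one. *)
Lemma card_le_sum_edeg A (G : {set {set T}}) :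
  (forall c, c \in G -> exists2 a, a \in A & a \in c) ->
  #|G| <= \sum_(a in A) edeg G a.
Proof.
move=> H; rewrite /edeg.
under eq_bigr => x _ do rewrite -sum1dep_card big_mkcondr /=.
rewrite exchange_big /= -sum1_card; apply: leq_sum => c /H[a aA ac].
by rewrite (bigD1 a) //= ac.
Qed.

Lemma sum_le_max (U : finType) (A : {set U}) (g : U -> nat) m :
  (forall x, x \in A -> g x <= m) -> \sum_(x in A) g x <= #|A| * m.
Proof. by move=> H; rewrite -sum_nat_const; apply: leq_sum. Qed.

(** Killing [v] of largest degree keeps the bound [K] on the degrees: if [v] is an
    end of the new edge [b], then [b] disappears; otherwise the degree of [v], hence
    the maximum, is at most [K] even with [b].  The
    degree [D] of [v] is at least the average degree.  The degree [w] of the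
    best non-neighbour is about the average too, since the at most [K.+1]
    neighbours of [v] carry at most [K.+1 * K.+1] edges. *)
Lemma kill_step_left A P B K b v :
    [disjoint A & P] -> #|A| = #|P| -> v \in A ->
    (forall z, edeg (cross A P B) z <= K) -> K.+1 < #|A| ->
    (forall z, edeg (cross A P (b |: B)) z <= edeg (cross A P (b |: B)) v) ->
  exists2 p, p \in P & let G' := cross (A :\ v) (P :\ p) (b |: B) in
  let D := edeg (cross A P (b |: B)) v in
  [/\ [set v; p] \notin b |: B, forall z, edeg G' z <= K,
    forall z, edeg G' z <= D &
  exists w, [/\ #|G'| + D + w <= #|cross A P B|.+1,
    #|cross A P B| <= #|A| * D & #|cross A P B| <= #|A| * w + K.+1 * K.+1]].
Proof.
move=> dis cAP vA degK K1 vmax; set G := cross A P (b |: B) in vmax *.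
have degG z : edeg G z <= edeg (cross A P B) z + (z \in b).
  by apply: leq_trans (edeg_add _ _ _); apply/edeg_sub/cross_add.
have vK : edeg G v <= K.+1.
  by rewrite (leq_trans (degG v)) // -addn1 leq_add ?degK ?leq_b1.
pose Pv := [set p in P | [set v; p] \notin b |: B].
pose Nv := [set p in P | [set v; p] \in b |: B].
have cNv : #|Nv| <= edeg G v.
  apply: (@leq_trans #|[set p in P | [set v; p] \in G]|).
    apply/subset_leq_card/subsetP => p; rewrite [p \in Nv]inE => /andP[pP H].
    by rewrite inE pP; apply/crossP; split => //; exists v, p.
  exact: (@card_nbrs_le T T id).
have cPvNv : #|Pv| + #|Nv| = #|P|.
  have NP : Nv :&: Pv = set0.
    by apply/setP => p; rewrite !inE; case: (p \in P) => //=; case: (_ || _).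
  rewrite addnC -cardsUI NP cards0 addn0; apply: eq_card => p.
  by rewrite inE [p \in Nv]inE [p \in Pv]inE; case: (p \in P) => //=; rewrite orbN.
have [p0 p0P] : exists p, p \in Pv.
  by apply/set0Pn; rewrite -card_gt0; lia.
pose p := [arg max_(q > p0 in Pv) edeg G q].
have [pPv pmax] : p \in Pv /\ forall q, q \in Pv -> edeg G q <= edeg G p.
  by rewrite /p; case: arg_maxnP.
move: (pPv); rewrite inE => /andP[pP vp].
exists p => //.
have sub := cross_rem (b |: B) dis vA pP.
have G'G : cross (A :\ v) (P :\ p) (b |: B) \subset G.
  by apply: subset_trans sub _; apply/subsetP => c; rewrite inE => /andP[].
have G0G : #|cross A P B| <= #|G| by apply/subset_leq_card/cross_sub.
split=> //.
- move=> z; case: (boolP (v \in b)) => vb; last first.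
    apply: leq_trans (edeg_sub z G'G) _; apply: leq_trans (vmax z) _.
    by apply: leq_trans (degG v) _; rewrite (negbTE vb) addn0.
  apply: leq_trans (degK z); apply: edeg_sub; apply: subset_trans sub _.
  apply/subsetP => c; rewrite inE => /and3P[cG vc _].
  have /setU1P[E|//] := subsetP (cross_add A P B b) _ cG.
  by rewrite E vb in vc.
- by move=> z; apply: leq_trans (edeg_sub z G'G) (vmax z).
exists (edeg G p); split.
- pose Gv := [set c in G | v \in c]; pose Gp := [set c in G | p \in c].
  have GvGp : [disjoint Gv & Gp].
    apply/pred0P => c /=; apply/negP => /andP[].
    rewrite inE => /andP[cG vc]; rewrite inE => /andP[_ pc].
    move: cG vc pc => /crossP[cB [a [q [aA qP cE]]]]; rewrite cE !inE.
    case/orP=> [/eqP va|/eqP vq].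
      case/orP=> [/eqP pa|/eqP pq]; first by rewrite pa (disjointFr dis aA) in pP.
      by case/negP: vp; rewrite va pq -cE.
    by rewrite -vq (disjointFr dis vA) in qP.
  rewrite -[edeg G v]/(#|Gv|) -[edeg G p]/(#|Gp|) -addnA.
  have -> : #|Gv| + #|Gp| = #|Gv :|: Gp|.
    by apply/esym/eqP; rewrite (leq_card_setU Gv Gp).2.
  rewrite addnC.
  have : #|(Gv :|: Gp) :|: cross (A :\ v) (P :\ p) (b |: B)| <= #|cross A P B|.+1.
    apply: (@leq_trans #|b |: cross A P B|).
      apply: subset_leq_card; rewrite !subUset.
      apply/andP; split; first (apply/andP; split).
      1,2: by apply/subsetP => c; rewrite inE => /andP[/(subsetP (cross_add A P B b))].
      exact: subset_trans G'G (cross_add _ _ _ _).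
    by rewrite cardsU1; case: (_ \notin _).
  have /eqP <- : #|(Gv :|: Gp) :|: cross (A :\ v) (P :\ p) (b |: B)| ==
      #|Gv :|: Gp| + #|cross (A :\ v) (P :\ p) (b |: B)|.
    rewrite (leq_card_setU _ _).2 disjoint_sym.
    apply/pred0P => c /=; apply/negP => /andP[/(subsetP sub)].
    rewrite inE => /and3P[_ /negbTE vc /negbTE pc].
    by rewrite in_setU [c \in Gv]inE [c \in Gp]inE vc pc !andbF.
  by [].
- apply: leq_trans G0G _; apply: leq_trans (@card_le_sum_edeg A G _) _.
    by move=> c /crossP[_ [a [q [aA _ ->]]]]; exists a; rewrite // !inE eqxx.
  by apply: sum_le_max.
apply: leq_trans G0G _; apply: leq_trans (@card_le_sum_edeg P G _) _.
  by move=> c /crossP[_ [a [q [_ qP ->]]]]; exists q; rewrite // !inE eqxx orbT.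
rewrite (bigID (mem Pv)) /=; apply: leq_add.
  apply: (@leq_trans (#|Pv| * edeg G p)).
    rewrite (eq_bigl (mem Pv)); first exact: sum_le_max.
    by move=> q; rewrite !inE; case: (q \in P).
  by rewrite leq_mul2r; apply/orP; right; lia.
rewrite (eq_bigl (mem Nv)); last first.
  by move=> q; rewrite !inE; case: (q \in P) => //=; rewrite negbK.
apply: (@leq_trans (#|Nv| * K.+1)).
  by apply: sum_le_max => q _; apply: leq_trans vK.
by rewrite leq_mul2r; apply/orP; right; lia.
Qed.


(** The same, on whichever side the vertex of largest degree lies. *)
Lemma kill_step A P B K b :
    [disjoint A & P] -> #|A| = #|P| ->
    (forall z, edeg (cross A P B) z <= K) -> K.+1 < #|A| ->
  exists a p, [/\ a \in A, p \in P, [set a; p] \notin b |: B &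
  let G' := cross (A :\ a) (P :\ p) (b |: B) in
  exists D w, [/\ forall z, edeg G' z <= minn K D,
    #|G'| + D + w <= #|cross A P B|.+1,
    #|cross A P B| <= #|A| * D & #|cross A P B| <= #|A| * w + K.+1 * K.+1]].
Proof.
move=> dis cAP degK K1; set G := cross A P (b |: B).
have [v [vAP vmax]] : exists v, v \in A :|: P /\ forall z, edeg G z <= edeg G v.
  have /set0Pn[a0 a0A] : A != set0 by rewrite -card_gt0; lia.
  case: (@arg_maxnP T a0 predT (edeg G) isT) => v _ vmax.
  case: (boolP (v \in A :|: P)) => vAP; first by exists v; split=> // z; apply: vmax.
  exists a0; split=> [|z]; first by rewrite inE a0A.
  by apply: leq_trans (vmax z isT) _; rewrite -/G /G edeg_cross_out.
case/setUP: vAP => [vA|vP].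
  have [p pP /=] := kill_step_left dis cAP vA degK K1 vmax.
  case=> vp dK dD [w [H1 H2 H3]]; exists v, p; split=> //.
  by exists (edeg G v), w; split=> // z; rewrite leq_min dK dD.
rewrite disjoint_sym in dis; rewrite crossC in degK.
rewrite /G crossC in vmax; rewrite cAP in K1.
have [a aA /=] := kill_step_left dis (esym cAP) vP degK K1 vmax.
rewrite crossC setUC (crossC P) (crossC P) -cAP => -[vp dK dD [w [H1 H2 H3]]].
exists a, v; split=> //.
by exists (edeg G v), w; split=> // z; rewrite leq_min dK dD.
Qed.

Lemma cards_rem (A : {set T}) (a : T) r : a \in A -> #|A| = r.+1 -> #|A :\ a| = r.
Proof. by move=> aA; rewrite (cardsD1 a) aA => -[]. Qed.

Lemma disjoint_rem A P (a p : T) : [disjoint A & P] -> [disjoint A :\ a & P :\ p].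
Proof.
move=> dis; apply: disjointWl (subsetDl _ _) _.
exact: disjointWr (subsetDl _ _) dis.
Qed.

(** Degrees at most 1 persist by [kill_step] while at least three pairs are left.
    With two pairs left, some [a] is not joined to [P] by the new edge, so it still
    has at most one neighbour among two. *)
Lemma matching_wins_match r A P B :
  [disjoint A & P] -> #|A| = r.+1 -> #|P| = r.+1 ->
  (forall z, edeg (cross A P B) z <= 1) -> matching_wins r A P B.
Proof.
elim: r A P B => [//|r IH] A P B dis cA cP deg1 b.
case: (ltnP 2 #|A|) => [lt2|le2].
  have [|a [p [aA pP ap [D [w [dK _ _ _]]]]]] := kill_step b dis _ deg1 lt2.
    by rewrite cA cP.
  exists a, p; split=> //; apply: IH.
  - exact: disjoint_rem.
  - exact: cards_rem cA.
  - exact: cards_rem cP.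
  - by move=> z; apply: leq_trans (dK z) (geq_minl _ _).
have r0 : r = 0 by lia.
rewrite {IH}r0 in cA cP *.
suff [a [p [aA pP ap]]] : exists a p, [/\ a \in A, p \in P & [set a; p] \notin b |: B].
  by exists a, p.
have [a aA ab] : exists2 a, a \in A & forall p, p \in P -> [set a; p] != b.
  have [a0 [a1 [a0A a1A /eqP a01]]] : exists a0 a1, [/\ a0 \in A, a1 \in A & a0 != a1].
    have /card_gt0P[a0 a0A] : 0 < #|A| by rewrite cA.
    have /card_gt0P[a1 /setD1P[a10 a1A]] : 0 < #|A :\ a0| by rewrite (cards_rem a0A cA).
    by exists a0, a1; rewrite eq_sym.
  case: (pickP (fun p => (p \in P) && ([set a0; p] == b))) => [p /andP[pP /eqP bE]|H].
    exists a1 => // q qP; apply/eqP => E.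
    have : a0 \in [set a1; q] by rewrite E -bE !inE eqxx.
    rewrite !inE => /orP[/eqP//|/eqP a0q].
    by rewrite -a0q (disjointFr dis a0A) in qP.
  by exists a0 => // p pP; have := H p; rewrite pP /= => ->.
have : #|[set p in P | [set a; p] \in b |: B]| < #|P|.
  rewrite cP ltnS; apply: leq_trans (deg1 a).
  apply: leq_trans (@card_nbrs_le T T id P (cross A P B) a _); last by [].
  apply/subset_leq_card/subsetP => p; rewrite [p \in _]inE => /andP[pP].
  case/setU1P=> [/eqP E|pB]; first by rewrite (negbTE (ab p pP)) in E.
  by rewrite inE pP; apply/crossP; split=> //; exists a, p.
move=> /exists_notin[p pP]; rewrite inE pP /= => ap.
by exists a, p.
Qed.

(** From now on the degrees are at most [K] after each of Maker's moves.  The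
    error term of [kill_step] is [c].  The numbers of edges and of pairs are
    compared: the aim is to reach maximum degree 1 with pairs to spare. *)
Section Phases.
Variable K : nat.
Let c := K.+1 * K.+1.
Let R0 := c + K + 3.

(** As long as some degree is at least 2, the number of edges decreases in each
    round, and it has no more rounds to go than there are pairs. *)
Lemma matching_wins_few r A P B :
  [disjoint A & P] -> #|A| = r.+1 -> #|P| = r.+1 ->
  (forall z, edeg (cross A P B) z <= K) ->
  #|cross A P B| + K + 3 <= r.+1 -> matching_wins r A P B.
Proof.
elim: r A P B => [//|r IH] A P B dis cA cP degK few b.
have [||a [p [aA pP ap [D [w [dK H1 H2 H3]]]]]] := kill_step b dis _ degK.
- by rewrite cA cP.
- by rewrite cA; lia.
exists a, p; split=> //.
have [D1|D2] := leqP D 1.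
  apply: matching_wins_match; rewrite ?(cards_rem _ cA) ?(cards_rem _ cP) ?disjoint_rem //.
  by move=> z; apply: leq_trans (dK z) (leq_trans (geq_minr _ _) D1).
apply: IH; rewrite ?(cards_rem _ cA) ?(cards_rem _ cP) ?disjoint_rem //.
  by move=> z; apply: leq_trans (dK z) (geq_minl _ _).
by move: H1; set X := #|_|; lia.
Qed.

(** With more than [c] edges a non-neighbour of positive degree is available,
    so each round destroys at least three edges against one new: the number of
    edges decreases twice as fast as that of pairs. *)
Lemma matching_wins_linear r A P B :
  [disjoint A & P] -> #|A| = r.+1 -> #|P| = r.+1 ->
  (forall z, edeg (cross A P B) z <= K) -> R0 <= r.+1 ->
  #|cross A P B| <= c + 2 * (r.+1 - R0) -> matching_wins r A P B.
Proof.
elim: r A P B => [//|r IH] A P B dis cA cP degK rR few.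
have [le|lt] := leqP #|cross A P B| c.
  by apply: matching_wins_few => //; rewrite /R0 in rR; lia.
move=> b.
have [||a [p [aA pP ap [D [w [dK H1 H2 H3]]]]]] := kill_step b dis _ degK.
- by rewrite cA cP.
- by rewrite cA; rewrite /R0 in rR; lia.
exists a, p; split=> //.
have [D1|D2] := leqP D 1.
  apply: matching_wins_match; rewrite ?(cards_rem _ cA) ?(cards_rem _ cP) ?disjoint_rem //.
  by move=> z; apply: leq_trans (dK z) (leq_trans (geq_minr _ _) D1).
have w1 : 0 < w by case: w H3 {H1} => //; rewrite muln0 -/c; lia.
apply: IH; rewrite ?(cards_rem _ cA) ?(cards_rem _ cP) ?disjoint_rem //.
- by move=> z; apply: leq_trans (dK z) (geq_minl _ _).
- lia.
by move: H1; set X := #|_|; lia.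
Qed.

(** More than [j.+1 * r + c] edges force both degrees in [kill_step] to be at
    least [j.+2]; hence half of the remaining rounds suffice to bring the average
    degree down by one, which explains the factor [2 ^ j.+1]. *)
Lemma matching_wins_phase j r A P B :
  [disjoint A & P] -> #|A| = r.+1 -> #|P| = r.+1 ->
  (forall z, edeg (cross A P B) z <= K) -> 2 ^ j.+1 * R0 <= r.+1 ->
  #|cross A P B| <= j.+1 * r.+1 + c -> matching_wins r A P B.
Proof.
elim: j r A P B => [|j IHj] r A P B dis cA cP degK rR few.
  by apply: matching_wins_linear => //; lia.
pose R := 2 ^ j.+1 * R0.
have {rR} rR : 2 * R <= r.+1 by rewrite /R mulnA -expnS.
have {few} : #|cross A P B| <= j.+1 * r.+1 + c + j.+2 * (r.+1 - R).
  apply: leq_trans few _; nia.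
have {rR} : R <= r.+1 by lia.
elim: r A P B dis cA cP degK => [|r IH] A P B dis cA cP degK rR few.
  by [].
have [le|lt] := leqP #|cross A P B| (j.+1 * r.+2 + c).
  exact: IHj.
have RR0 : R0 <= R by rewrite /R leq_pmull // expn_gt0.
move=> b.
have [||a [p [aA pP ap [D [w [dK H1 H2 H3]]]]]] := kill_step b dis _ degK.
- by rewrite cA cP.
- by rewrite cA; rewrite /R0 in RR0; lia.
exists a, p; split=> //; rewrite cA in H2 H3.
have D2 : j.+1 < D by rewrite -(ltn_pmul2l (ltn0Sn r.+1)) mulnC; lia.
have w2 : j.+1 < w by rewrite -(ltn_pmul2l (ltn0Sn r.+1)) mulnC; lia.
apply: IH; rewrite ?(cards_rem _ cA) ?(cards_rem _ cP) ?disjoint_rem //.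
- by move=> z; apply: leq_trans (dK z) (geq_minl _ _).
- by case: ltngtP rR few => // -> _; rewrite subnn muln0 addn0 leqNgt lt.
have RE : r.+2 - R = (r.+1 - R).+1 by lia.
move: few H1; rewrite RE !mulnS.
move: #|cross A P B| #|cross _ _ _| (j.+1 * _) (j.+2 * _) => x y z t; lia.
Qed.

Lemma matching_wins_bounded_degree r A P B : 0 < K ->
  [disjoint A & P] -> #|A| = r.+1 -> #|P| = r.+1 ->
  (forall z, edeg (cross A P B) z <= K) -> 2 ^ K * R0 <= r.+1 -> matching_wins r A P B.
Proof.
case E: K => [//|j] _ dis cA cP degK rR.
apply: (@matching_wins_phase j); rewrite ?E //.
rewrite (leq_trans _ (leq_addr _ _)) //.
apply: leq_trans (@card_le_sum_edeg A (cross A P B) _) _.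
  by move=> x /crossP[_ [a [q [aA _ ->]]]]; exists a; rewrite // !inE eqxx.
by rewrite -cA mulnC; apply: sum_le_max.
Qed.

(** A large degree cap is first reduced to the constant [K]: as long as the
    degree exceeds [K], each round destroys [K] edges more than Breaker adds. *)
Lemma matching_wins_capped_degree cap R r A P B : 0 < K -> cap.+1 < R -> 2 ^ K * R0 < R ->
  [disjoint A & P] -> #|A| = r.+1 -> #|P| = r.+1 ->
  (forall z, edeg (cross A P B) z <= cap) -> R <= r.+1 ->
  #|cross A P B| <= K * (r.+1 - R) -> matching_wins r A P B.
Proof.
move=> K0 capR RR; elim: r A P B => [//|r IH] A P B dis cA cP degK rR few b.
have [||a [p [aA pP ap [D [w [dK H1 H2 H3]]]]]] := kill_step b dis _ degK.
- by rewrite cA cP.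
- by rewrite cA; lia.
exists a, p; split=> //.
have [D1|D2] := leqP D K.
  apply: matching_wins_bounded_degree => //; rewrite ?(cards_rem _ cA) ?(cards_rem _ cP) ?disjoint_rem //.
    by move=> z; apply: leq_trans (dK z) (leq_trans (geq_minr _ _) D1).
  lia.
have [E|NE] := eqVneq R r.+2.
  by move: few H1; rewrite E subnn muln0; set X := #|_|; lia.
apply: IH; rewrite ?(cards_rem _ cA) ?(cards_rem _ cP) ?disjoint_rem //.
- by move=> z; apply: leq_trans (dK z) (geq_minl _ _).
- lia.
have RE : r.+2 - R = (r.+1 - R).+1 by lia.
move: few H1; rewrite RE mulnS.
move: #|cross A P B| #|cross _ _ _| (K * _) => x y z; lia.
Qed.

End Phases.
End Matching.

(** * Rooted trees *)

Section Rooting.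
Variables (V : finType) (e : rel V).

(** A rooting of the tree, described by parents; [d] serves only for inductions
    towards the root. *)
Record rooted (r : V) (par : V -> V) (d : V -> nat) : Prop := Rooted {
  par_root : par r = r;
  par_edge : forall x, x != r -> e x (par x);
  par_depth : forall x, x != r -> d (par x) < d x;
  edge_par : forall x y, e x y -> (x != r /\ par x = y) \/ (y != r /\ par y = x)
}.

Definition nbhd (S : {set V}) : {set V} := S :|: [set y | [exists x in S, e x y]].

Lemma connect_ball r x : connect e r x -> exists k, x \in iter k nbhd [set r].
Proof.
case/connectP=> p; elim/last_ind: p x => [|p y IH] x /=.
  by move=> _ ->; exists 0; rewrite !inE.
rewrite rcons_path last_rcons => /andP[ep ey] ->.
have [k Hk] := IH _ ep (erefl _); exists k.+1; rewrite /= inE; apply/orP; right.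
by rewrite inE; apply/existsP; exists (last r p); rewrite Hk.
Qed.

(** Parents are neighbours closer to the root.  Were some edge xy not of the form
    vertex-parent, both ends would still be joined to the root, hence to each
    other, without it, and xy would close a cycle. *)
Lemma rooting r : is_tree e -> exists par d, rooted r par d.
Proof.
case=> -[e_sym eirr] [_ econn] eacyc.
have ball x : exists k, x \in iter k nbhd [set r] by apply: connect_ball.
pose d x := ex_minn (ball x).
have dP x : x \in iter (d x) nbhd [set r] /\
    forall k, x \in iter k nbhd [set r] -> d x <= k.
  by rewrite /d; case: ex_minnP.
have up x : x != r -> exists y, e x y && (d y < d x).
  move=> xr; have [] := dP x; case dx: (d x) => [|k] /=.
    by rewrite inE (negbTE xr).
  rewrite inE => /orP[xk /(_ k xk)|]; first by rewrite ltnn.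
  rewrite inE => /existsP[y /andP[yk eyx]] _; exists y.
  by rewrite e_sym eyx ltnS; apply: (dP y).2.
pose par x := if x == r then r else odflt r [pick y | e x y && (d y < d x)].
have parP x : x != r -> e x (par x) /\ d (par x) < d x.
  rewrite /par => xr; rewrite (negbTE xr); case: pickP => [y /andP[]//|H].
  by have [y] := up x xr; rewrite H.
exists par, d; split.
- by rewrite /par eqxx.
- by move=> x /parP[].
- by move=> x /parP[].
move=> x y exy.
case: (boolP ((x != r) && (par x == y))) => [/andP[? /eqP]|nx]; first by left.
case: (boolP ((y != r) && (par y == x))) => [/andP[? /eqP]|ny]; first by right.
(* here xy is no parent edge: a path from y to x avoiding it gives a cycle *)
exfalso; pose e' := [rel u v | e u v && ([set u; v] != [set x; y])].
have e'sym : symmetric e' by move=> u v /=; rewrite e_sym setUC.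
have set2E (u v : V) : [set u; v] = [set x; y] -> (u = x /\ v = y) \/ (u = y /\ v = x).
  move=> E; have : u \in [set x; y] by rewrite -E !inE eqxx.
  case/set2P=> uE; rewrite uE in E *; first by left; rewrite (set2_injr E).
  by right; rewrite [RHS]setUC in E; rewrite (set2_injr E).
have to_root u : connect e' u r.
  have [k] := ubnP (d u); elim: k u => [//|k IH] u dk.
  case: (eqVneq u r) => [->|ur]; first exact: connect0.
  have [eu du] := parP u ur; apply: connect_trans (IH (par u) _); last by lia.
  apply: connect1 => /=; rewrite eu /=; apply/eqP => /set2E[] [E1 E2].
    by rewrite -E1 E2 ur eqxx in nx.
  by rewrite -E1 E2 ur eqxx in ny.
have /connectP[p ep yE] : connect e' y x.
  apply: connect_trans (to_root y) _; rewrite sym_connect_sym //.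
case/shortenP: ep yE => p' ep' up' _ yE.
have sub : subrel e' e by move=> u v /andP[].
have p'E := sub_path sub ep'.
case: p' ep' up' yE p'E => [|z [|z' p']] ep' up' yE p'E.
- by move: exy; rewrite yE /= eirr.
- by move: ep'; rewrite /= andbT => /andP[_]; rewrite yE /= setUC eqxx.
case: (eacyc [:: y, z, z' & p']) => //.
rewrite /ucycle up' andbT /cycle rcons_path p'E /=.
by move: exy; rewrite yE.
Qed.

End Rooting.

(** Double counting: [X] is covered by sets indexed by [Y], of size at most [m]. *)
Lemma card_fiber_le (U W : finType) (X : {set U}) (Y : {set W})
    (R : U -> W -> bool) m :
  (forall x, x \in X -> exists2 y, y \in Y & R x y) ->
  (forall y, y \in Y -> #|[set x in X | R x y]| <= m) -> #|X| <= #|Y| * m.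
Proof.
move=> cov fib; rewrite -sum1_card.
apply: (@leq_trans (\sum_(x in X) \sum_(y in Y) R x y)).
  by apply: leq_sum => x /cov[y yY Rxy]; rewrite (bigD1 y) //= Rxy.
rewrite exchange_big /=; apply: sum_le_max => y /fib; apply: leq_trans.
rewrite -sum1dep_card [leqRHS]big_mkcondr /=.
by apply: leq_sum => x _; case: (R x y).
Qed.

Section RootedTree.
Variables (V : finType) (e : rel V) (r : V) (par : V -> V) (d : V -> nat).
Hypotheses (e_sym : symmetric e) (rt : rooted e r par d).
Variable Delta : nat.
Hypothesis degD : forall x, degree e x <= Delta.

Definition children u : {set V} := [set x | (x != r) && (par x == u)].

Lemma childP u x : reflect (x != r /\ par x = u) (x \in children u).
Proof. by rewrite inE; apply: (iffP andP) => -[? /eqP]. Qed.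

Lemma card_children u : #|children u| <= Delta.
Proof.
apply: leq_trans (degD u); apply/subset_leq_card/subsetP => x /childP[xr <-].
by rewrite inE e_sym (par_edge rt).
Qed.

Lemma degree_two u : u != r -> #|children u| = 1 -> degree e u = 2.
Proof.
move=> ur c1; rewrite /degree (_ : [set y | e u y] = par u |: children u).
  rewrite cardsU1 c1 (_ : par u \notin children u) //.
  apply/negP => /childP[pr E].
  have := par_depth rt pr; have := par_depth rt ur; rewrite E; lia.
apply/setP => y; rewrite inE in_setU1; apply/idP/orP.
  by case/(edge_par rt) => -[xr E]; [left; rewrite E|right; apply/childP].
case=> [/eqP->|/childP[yr <-]]; first exact: par_edge rt _ ur.
by rewrite e_sym (par_edge rt).
Qed.

Lemma card_par_fiber y : #|[set x | par x == y]| <= Delta.+1.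
Proof.
apply: (@leq_trans #|r |: children y|).
  apply/subset_leq_card/subsetP => x; rewrite !inE => ->.
  by case: (x == r).
by rewrite cardsU1 -add1n leq_add ?leq_b1 ?card_children.
Qed.

Lemma card_iter_fiber j s : #|[set x | iter j par x == s]| <= Delta.+1 ^ j.
Proof.
elim: j => [|j IH].
  by rewrite (_ : [set _ | _] = [set s]) ?cards1 //; apply/setP => x; rewrite !inE.
rewrite expnSr; apply: leq_trans (leq_mul IH (leqnn _)).
apply: (@card_fiber_le _ _ _ _ (fun x y => par x == y)) => [x|y _].
  by rewrite inE iterSr => xs; exists (par x); rewrite ?inE.
by apply: leq_trans (card_par_fiber y); apply/subset_leq_card/subsetP => x; rewrite !inE => /andP[].
Qed.

Definition upclosed (S : {set V}) := r \in S /\ forall x, x \in S -> par x \in S.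

(** The places where an embedding of [S] can be extended. *)
Definition opens (S : {set V}) : {set V} := [set u in S | ~~ (children u \subset S)].

Lemma openP (S : {set V}) u :
  reflect (u \in S /\ exists x, [/\ x \notin S, x != r & par x = u]) (u \in opens S).
Proof.
rewrite inE; apply: (iffP andP) => -[uS].
  by case/subsetPn=> x /childP[xr px] xS; split=> //; exists x.
by case=> x [xS xr px]; split=> //; apply/subsetPn; exists x => //; apply/childP.
Qed.

Definition leaf x := (x != r) && (children x == set0).

(** The choice made by [pick] depends on the parent only, so one leaf is kept for
    each parent of a leaf. *)
Definition leaves : {set V} :=
  [set x | leaf x && ([pick y | leaf y && (par y == par x)] == Some x)].

Lemma leaves_leaf x : x \in leaves -> leaf x.
Proof. by rewrite inE => /andP[]. Qed.

Lemma leaf_sibling x : leaf x -> exists2 z, z \in leaves & par z = par x.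
Proof.
move=> lx; case E: [pick y | leaf y && (par y == par x)] => [z|].
  have /andP[lz /eqP pz] : leaf z && (par z == par x).
    by move: E; case: pickP => // z' H [<-].
  by exists z => //; rewrite inE lz /= pz E.
by move: E; case: pickP => // /(_ x); rewrite lx eqxx.
Qed.

Lemma par_inj_leaves : {in leaves &, injective par}.
Proof.
by move=> x y; rewrite !inE => /andP[_ /eqP+] /andP[_ /eqP+] E; rewrite E => -> [].
Qed.


Lemma sum_children_in S : upclosed S -> (\sum_(u in S) #|children u :&: S|).+1 = #|S|.
Proof.
case=> rS upS; rewrite [RHS](cardsD1 r) rS; congr _.+1.
rewrite -[RHS]sum1_card [RHS](partition_big par (mem S)) /=.
  apply: eq_bigr => u uS; rewrite -sum1_card; apply: eq_bigl => x.
  by rewrite !inE -andbA [(_ == u) && _]andbC andbA.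
by move=> x /setD1P[_ /upS].
Qed.

(** The numbers of children inside [S] add up to [#|S| - 1], so on average a
    vertex has less than one child, and a branching has to be compensated by a
    vertex without children. *)
Lemma card_branching S : upclosed S ->
  #|[set u in S | 1 < #|children u :&: S|]| < #|[set u in S | children u :&: S == set0]|.
Proof.
move=> upS; have := sum_children_in upS.
set br := [set u in S | 1 < _]; set lf := [set u in S | _ == set0].
suff : #|S| + #|br| <= \sum_(u in S) #|children u :&: S| + #|lf| by lia.
rewrite -[#|S|]sum1_card -!sum1dep_card !big_mkcondr /= -!big_split /=.
apply: leq_sum => u _; rewrite -cards_eq0.
by case: #|_| => [|[|k]].
Qed.

(** Since [Q] is large, not all of it is within distance one of [S]; going up from
    a vertex of [Q] at larger distance one meets [S], without leaving [Q], at a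
    vertex below which at least two vertices outside [S] lie on the way. *)
Lemma deep_slot S (Q : {set V}) : upclosed S ->
    (forall z, z \in Q -> z \notin S -> par z \in Q) -> Delta.+1 * #|S| < #|Q| ->
  exists u x y, [/\ u \in S :&: Q, x \notin S, y \notin S & x != r /\ y != r] /\
    par x = u /\ par y = x.
Proof.
move=> [rS upS] upQ big.
have nr z : z \notin S -> z != r by apply: contraNneq => ->.
have [y yQ yNS] : exists2 y, y \in Q & (y \notin S) && (par y \notin S).
  have [|y yQ] := @exists_notin V Q (\bigcup_(u in S) (u |: children u)).
    apply: leq_ltn_trans big; rewrite mulnC.
    apply: (@card_fiber_le _ _ _ _ (fun x u => x \in u |: children u)).
      by move=> x /bigcupP[u]; exists u.
    move=> u _; apply: leq_trans (_ : #|u |: children u| <= _).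
      by apply/subset_leq_card/subsetP => x; rewrite inE => /andP[].
    by rewrite cardsU1 -add1n leq_add ?leq_b1 ?card_children.
  move=> yn; exists y => //; apply/andP; split; apply: contra yn => H; apply/bigcupP.
    by exists y; rewrite // !inE eqxx.
  case: (boolP (y \in S)) => yS; first by exists y; rewrite // !inE eqxx.
  by exists (par y) => //; apply/setU1P; right; apply/childP; rewrite nr.
have [k] := ubnP (d y); elim: k y yQ yNS => [//|k IH] y yQ /andP[yS pS] dk.
have pQ := upQ y yQ yS.
case: (boolP (par (par y) \in S)) => ppS.
  exists (par (par y)), (par y), y; split=> //; split=> //; last by rewrite !nr.
  by rewrite inE ppS upQ.
apply: (IH (par y)) => //; first by rewrite pS.
have := par_depth rt (nr _ yS); lia.
Qed.


Definition below u : {set V} := [set z | fconnect par z u].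

Lemma below_par u z : par z \in below u -> z \in below u.
Proof. by rewrite !inE; apply: connect_trans; apply: fconnect1. Qed.

Lemma par_below u z : z \in below u -> z != u -> par z \in below u.
Proof.
rewrite !inE => /iter_findex; case: (findex _ _ _) => [|k]; first by move=> /= ->; rewrite eqxx.
by rewrite iterSr => <- _; apply: fconnect_iter.
Qed.

Lemma below_root z : z \in below r.
Proof.
have [k] := ubnP (d z); elim: k z => [//|k IH] z dk.
case: (eqVneq z r) => [->|zr]; first by rewrite inE connect0.
by apply/below_par/IH; have := par_depth rt zr; lia.
Qed.

Lemma root_below u : r \in below u -> u = r.
Proof.
rewrite inE => /iter_findex; elim: (findex _ _ _) => [//|k IH].
by rewrite iterSr (par_root rt).
Qed.

Lemma depth_below u z : z \in below u -> d u <= d z.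
Proof.
have [k] := ubnP (d z); elim: k z => [//|k IH] z dk zu.
case: (eqVneq z u) => [->//|zNu].
case: (eqVneq z r) => [zr|zr]; first by rewrite zr in zu zNu; rewrite (root_below zu) eqxx in zNu.
have := par_depth rt zr; have := IH (par z) _ (par_below zu zNu); lia.
Qed.

Lemma below_children u z : z \in below u -> z != u -> exists2 v, v \in children u & z \in below v.
Proof.
have [k] := ubnP (d z); elim: k z => [//|k IH] z dk zu zNu.
case: (eqVneq z r) => [zr|zr]; first by rewrite zr in zu zNu; rewrite (root_below zu) eqxx in zNu.
case: (eqVneq (par z) u) => [pz|pz].
  by exists z; [apply/childP|rewrite inE connect0].
have [|v vu zv] := IH (par z) _ (par_below zu zNu) pz; first by have := par_depth rt zr; lia.
by exists v => //; apply: below_par.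
Qed.

(** Take a minimal subtree [below c] with at least half of the vertices: each of
    its at most [Delta] branches has less than half of them, and the largest
    branch [Q] has about a [Delta]-th part of it. *)
Lemma balanced_edge : 2 < #|V| -> exists c1 c2 (Q : {set V}),
  [/\ e c1 c2, c1 \notin Q & c2 \in Q] /\
  [/\ forall x y, x \in Q -> y \notin Q -> e x y -> x = c2 /\ y = c1,
     #|V| <= 2 * (Delta * #|Q|) + 2 & #|V| <= 2 * #|~: Q|].
Proof.
move=> V2; pose big u := #|V| <= 2 * #|below u|.
have bigr : big r.
  by rewrite /big (_ : below r = setT) ?cardsT ?leq_pmull //; apply/setP => z; rewrite below_root inE.
case: (@arg_minnP V r big (fun u => #|below u|) bigr) => c bigc cmin.
have split_c m : (forall u, u \in children c -> #|below u| <= m) -> #|below c| <= (Delta * m).+1.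
  move=> H; rewrite (cardsD1 c) -add1n leq_add ?leq_b1 //.
  apply: leq_trans (leq_mul (card_children c) (leqnn m)).
  apply: (@card_fiber_le _ _ _ _ (fun z u => z \in below u)).
    by move=> z /setD1P[zc] /below_children; apply.
  move=> u /H; apply: leq_trans; apply/subset_leq_card/subsetP => z.
  by rewrite inE => /andP[].
have [u0 u0c] : exists u, u \in children c.
  apply/set0Pn/eqP => c0; have : #|below c| <= 1.
    by have := @split_c 0; rewrite muln0; apply => u; rewrite c0 inE.
  by move: bigc; rewrite /big; lia.
case: (@arg_maxnP V u0 (mem (children c)) (fun u => #|below u|) u0c) => u uc umax.
have [ur pu] := childP _ _ uc.
have cu : c \notin below u.
  by apply/negP => /depth_below; have := par_depth rt ur; rewrite pu; lia.
have uu : u \in below u by rewrite inE connect0.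
exists c, u, (below u); split; split => //.
- by rewrite e_sym -pu; apply: par_edge rt _ ur.
- move=> x y xu yu /(edge_par rt)[] [nr E].
    case: (eqVneq x u) => [xE|xNu]; first by split=> //; rewrite -E xE.
    by rewrite -E (par_below xu xNu) in yu.
  by rewrite below_par ?E in yu.
- have := split_c _ umax; move: bigc; rewrite /big; lia.
have lt : #|below u| < #|below c|.
  apply: proper_card; apply/properP; split; last by exists c; rewrite // inE connect0.
  apply/subsetP => z zu; move: (zu); rewrite !inE => H; apply: connect_trans H _.
  by rewrite -pu; apply: fconnect1.
have := cardsC (below u); have := cmin u; rewrite /big; lia.
Qed.

Variable m2 : nat.
Hypotheses (m20 : 0 < m2) (nobare : ~ has_bare_path e m2).

Lemma depth_iter x j : (forall i, i < j -> iter i par x != r) ->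
  d (iter j par x) + j <= d x.
Proof.
elim: j => [|j IH] H; first by rewrite addn0.
have := par_depth rt (H j (leqnn _)).
have := IH (fun i ij => H i (ltnW ij)); rewrite /=; lia.
Qed.

(** Otherwise the [m2] steps up from [x] would pass only through vertices whose
    single child is the previous vertex of the path: a bare path of length [m2]. *)
Lemma special_above S x : upclosed S -> x \in S ->
  exists2 s, s \in r |: (opens S :|: [set u in S | 1 < #|children u :&: S|]) &
    [exists j : 'I_m2.+1, iter j par x == s].
Proof.
move=> [rS upS] xS; set Sp := r |: _.
case: (boolP [exists j : 'I_m2.+1, iter j par x \in Sp]) => [/existsP[j Hj]|].
  by exists (iter j par x) => //; apply/existsP; exists j.
rewrite negb_exists => /forallP H; case: nobare.
have Hn j : j <= m2 -> iter j par x \notin Sp by move=> jm; apply: (H (Ordinal (jm : j < m2.+1))).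
have Hr j : j <= m2 -> iter j par x != r.
  by move=> /Hn; rewrite !inE negb_or => /andP[].
have iS j : iter j par x \in S by elim: j => //= j; apply: upS.
exists x, (traject par (par x) m2); split; last by rewrite size_traject.
have nthP j : nth x (x :: traject par (par x) m2) j = if j <= m2 then iter j par x else x.
  rewrite -trajectS; case: leqP => jm; first by rewrite nth_traject.
  by rewrite nth_default // size_traject.
split.
- apply/(pathP x) => j; rewrite size_traject => jm.
  rewrite nthP (ltnW jm) (set_nth_default (par x)) ?size_traject // nth_traject // -iterSr /=.
  exact: par_edge rt _ (Hr _ (ltnW jm)).
- apply/(uniqP x) => i j; rewrite !inE /= size_traject !ltnS => im jm.
  rewrite !nthP im jm => E.
  wlog ij : i j im jm E / i <= j.
    by move=> W; case/orP: (leq_total i j) => ?; [|apply/esym]; apply: W.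
  have [k kE] : exists k, j = k + i by exists (j - i); rewrite subnK.
  have H0 l : l < k -> iter l par (iter i par x) != r.
    by move=> lk; rewrite -iterD; apply: Hr; lia.
  have := depth_iter H0; rewrite -iterD -kE -E; lia.
have -> : behead (belast x (traject par (par x) m2)) = traject par (par x) m2.-1.
  case: m2 m20 => [//|m'] _; rewrite -[belast _ _]/(belast x (traject par (par x) m'.+1)).
  by rewrite trajectSr belast_rcons.
move=> y /trajectP[j jm ->]; rewrite -iterSr.
have jm2 : j.+1 <= m2 by lia.
have := Hn _ jm2; rewrite !inE !negb_or iS /= => /and3P[ur]; rewrite negbK -leqNgt.
move=> sub; rewrite (setIidPl sub) => c1; apply: degree_two => //.
apply/eqP; rewrite eqn_leq c1 card_gt0; apply/set0Pn; exists (iter j par x).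
by apply/childP; split=> //; apply: Hr; lia.
Qed.

(** By [special_above] the set [S] is covered by boundedly large balls below the
    special vertices.  Among these the branchings are fewer than the vertices
    without children in [S], and the latter are open, or siblings of a reserved
    leaf and thus children of an open vertex. *)
Lemma card_opens S : 1 < #|V| -> upclosed S -> [disjoint S & leaves] ->
  #|S| <= Delta.+2 * (m2.+1 * Delta.+1 ^ m2) * #|opens S|.
Proof.
move=> V1 upS disL; have [rS upS'] := upS.
have lam : #|[set u in S | children u :&: S == set0]| <= #|opens S| * Delta.+1.
  apply: (@card_fiber_le _ _ _ _ (fun u o => (u == o) || ((u != r) && (par u == o)))).
    move=> u; rewrite inE => /andP[uS u0].
    case: (boolP (u \in opens S)) => uo; first by exists u; rewrite // eqxx.
    have chu : children u == set0.
      rewrite inE uS negbK /= in uo; rewrite -(eqP u0).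
      by apply/eqP/esym/setIidPl.
    case: (eqVneq u r) => [ur|ur].
      (* the root has a child, being not the only vertex *)
      have [y yr] : exists y, y != r.
        apply/existsP; rewrite -negb_forall; apply/negP => /forallP H.
        have : #|V| <= 1; last by lia.
        by apply/card_le1_eqP => a b _ _; rewrite (eqP (H a)) (eqP (H b)).
      have [k] := ubnP (d y); elim: k y yr => [//|k IH] y yr dk.
      case: (eqVneq (par y) r) => [pr|pr].
        by have : y \in children u; [apply/childP; rewrite pr ur|rewrite (eqP chu) inE].
      by apply: (IH (par y)) => //; have := par_depth rt yr; lia.
    have [|z zL zp] := @leaf_sibling u; first by rewrite /leaf ur.
    exists (par u); last by rewrite /= eqxx orbT.
    apply/openP; split; first exact: upS'.
    exists z; split=> //; first by rewrite (disjointFl disL zL).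
    by case/andP: (leaves_leaf zL).
  move=> o _; apply: leq_trans (_ : #|o |: children o| <= _).
    by apply/subset_leq_card/subsetP => u; rewrite !inE => /andP[_].
  by rewrite cardsU1 -add1n leq_add ?leq_b1 ?card_children.
have br := card_branching upS.
set br_set := [set u in S | 1 < _] in br *.
have S1 : #|S| <= #|r |: (opens S :|: br_set)| * (m2.+1 * Delta.+1 ^ m2).
  apply: (@card_fiber_le _ _ _ _ (fun x s => [exists j : 'I_m2.+1, iter j par x == s])).
    by move=> x xS; apply: special_above.
  move=> s _; apply: (@leq_trans (#|[set: 'I_m2.+1]| * Delta.+1 ^ m2)); last by rewrite cardsT card_ord.
  apply: (@card_fiber_le _ _ _ _ (fun x (j : 'I_m2.+1) => iter j par x == s)).
    by move=> x; rewrite inE => /andP[_ /existsP[j]]; exists j.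
  move=> j _; apply: leq_trans (leq_trans (card_iter_fiber j s) _).
    by apply/subset_leq_card/subsetP => x; rewrite !inE => /andP[].
  by rewrite leq_pexp2l // -ltnS.
apply: leq_trans S1 _; rewrite [leqRHS]mulnAC leq_mul2r; apply/orP; right.
have : #|r |: (opens S :|: br_set)| <= 1 + (#|opens S| + #|br_set|).
  by rewrite cardsU1 leq_add ?leq_b1 ?(leq_card_setU _ _).1.
lia.
Qed.


(** The set without the reserved leaves is open only at their parents. *)
Lemma card_leaves : 1 < #|V| ->
  #|V| <= (Delta.+2 * (m2.+1 * Delta.+1 ^ m2)).+1 * #|leaves|.
Proof.
move=> V1; have upL : upclosed (~: leaves).
  split=> [|x]; rewrite !in_setC.
    by apply/negP => /leaves_leaf; rewrite /leaf eqxx.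
  case: (eqVneq x r) => [xr|xr xL]; first by rewrite xr (par_root rt).
  apply/negP => /leaves_leaf/andP[_ /eqP c0].
  by have : x \in children (par x); [apply/childP|rewrite c0 inE].
have dis : [disjoint ~: leaves & leaves].
  by rewrite disjoint_subset; apply/subsetP => x; rewrite inE.
have := card_opens V1 upL dis; have := cardsC leaves.
have : #|opens (~: leaves)| <= #|leaves|.
  apply: leq_trans (leq_imset_card par leaves).
  apply/subset_leq_card/subsetP => u /openP[_ [x [xL _ <-]]].
  by apply: imset_f; rewrite in_setC negbK in xL.
move: (_ * _) #|opens _| => C o oL <- H; rewrite mulSn leq_add2l.
by apply: leq_trans H _; rewrite leq_mul2l oL orbT.
Qed.

End RootedTree.

(** * Partial embeddings and the final exchange *)

Definition upd (U W : eqType) (f : U -> W) x a := fun y => if y == x then a else f y.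

Lemma upd_eq (U W : eqType) (f : U -> W) x a : upd f x a x = a.
Proof. by rewrite /upd eqxx. Qed.

Lemma upd_neq (U W : eqType) (f : U -> W) x a y : y != x -> upd f x a y = f y.
Proof. by rewrite /upd => /negbTE->. Qed.

Lemma imset_upd (U W : finType) (f : U -> W) x a (S : {set U}) :
  x \notin S -> upd f x a @: S = f @: S.
Proof.
move=> xS; apply: eq_in_imset => y yS; apply: upd_neq.
by apply: contraNneq xS => <-.
Qed.

Definition swap (U W : eqType) (f : U -> W) u v := upd (upd f v (f u)) u (f v).

Lemma swap_inj (U W : eqType) (f : U -> W) u v : injective f -> injective (swap f u v).
Proof.
move=> fI y z; rewrite /swap /upd.
by case: (y =P u) => [->|?]; [|case: (y =P v) => [->|?]];
  (case: (z =P u) => [->|?]; [|case: (z =P v) => [->|?]]); move/fI; congruence.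
Qed.

Section Embedding.
Variables (V : finType) (e : rel V) (r : V) (par : V -> V) (d : V -> nat).
Hypotheses (rt : rooted e r par d).
Variable n : nat.
Implicit Types (f : V -> 'I_n) (S : {set V}) (B M : {set {set 'I_n}}).
Local Notation board := (complete_edges n).
Local Notation win := (wins board (tree_copies e n)).
Local Notation L := (leaves r par).

(** Maker's edges contain the image under [f] of the subtree [S]; the values of [f]
    outside [S] are meaningless. *)
Definition embeds (f : V -> 'I_n) (S : {set V}) (M : {set {set 'I_n}}) : Prop :=
  [/\ upclosed r par S, {in S &, injective f} &
      forall x, x \in S -> x != r -> [set f x; f (par x)] \in M].

Lemma par_neq x : x != r -> par x != x.
Proof. by move=> xr; apply/eqP => E; have := par_depth rt xr; rewrite E ltnn. Qed.

Lemma win_copy (f : V -> 'I_n) k (B M : {set {set 'I_n}}) : injective f ->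
  (forall x, x != r -> [set f x; f (par x)] \in M) -> win k B M.
Proof.
move=> fI fM; apply: (@wins_won _ _ _ _ _ _ (copy_edges e [ffun x => f x])).
  apply/imsetP; exists [ffun x => f x] => //; rewrite inE; apply/injectiveP.
  by move=> x y; rewrite !ffunE; apply: fI.
apply/subsetP => _ /imsetP[[u v] /= + ->]; rewrite inE /= !ffunE.
by case/(edge_par rt) => -[nr <-]; [|rewrite setUC]; apply: fM.
Qed.

Lemma embedsW f S (M M' : {set {set 'I_n}}) : M \subset M' -> embeds f S M -> embeds f S M'.
Proof. by move=> /subsetP MM [? ? H]; split=> // x xS xr; apply/MM/H. Qed.

Lemma embeds_upd f S M x a : embeds f S M -> x \notin S -> par x \in S ->
  a \notin f @: S -> embeds (upd f x a) (x |: S) ([set a; f (par x)] |: M).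
Proof.
case=> -[rS upS] fI fM xS pxS aS.
have neq y : y \in S -> y != x by move=> yS; apply: contraNneq xS => <-.
split.
- split; first by rewrite inE rS orbT.
  by move=> y /setU1P[->|/upS pyS]; rewrite in_setU1 ?pxS ?pyS orbT.
- move=> y z /setU1P[->|yS] /setU1P[->|zS] //; rewrite ?upd_eq ?upd_neq ?neq //.
  + by move=> aE; rewrite aE imset_f in aS.
  + by move=> aE; rewrite -aE imset_f in aS.
  exact: fI.
move=> y /setU1P[->|yS] yr; first by rewrite upd_eq upd_neq ?neq // setU11.
by rewrite !upd_neq ?neq ?upS // inE fM ?orbT.
Qed.

Lemma in_board (x y : 'I_n) : ([set x; y] \in board) = (x != y).
Proof. by rewrite inE cards2; case: (x == y). Qed.

Lemma leaf_par x y : x \in L -> y != r -> par y != x.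
Proof.
move=> /leaves_leaf/andP[_ /eqP c0] yr; apply/eqP => E.
by have : y \in children r par x; [apply/childP|rewrite c0 inE].
Qed.

(** The unused vertex [a] should play the leaf [x0], below [par x0].  Maker claims
    [a - f (par x)] for a leaf [x] and then [f (par x0) - f z] for a leaf [z].  Now
    [x0] can be played by [f z], and there are two candidates for [z]: [a] itself,
    or [f x], whose role is then taken by [a].  Hence two edges to [f (par z)] win,
    and Breaker can take only one.  Degree bounds leave room for [x] and [z]; the
    vertex [f x] is chosen light since it takes part in the second threat. *)
Lemma last_vertex q f x0 a B M :
    embeds f (~: [set x0]) M -> x0 \in L -> a \notin f @: (~: [set x0]) ->
    B \subset board -> #|B| <= n - 2 ->
    edeg B a <= q -> edeg B (f (par x0)) <= q ->
    2 * n < q.+2 * q -> 3 * q + 8 < #|L| ->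
  win 3 B M.
Proof.
move=> [[rS upS] fI fM] x0L aS BB cB dega degp nq bigL.
have nx0 y : (y \in ~: [set x0]) = (y != x0) by rewrite !inE.
have rx0 : r != x0 by rewrite -nx0.
have parx0 y : y != x0 -> par y != x0 by rewrite -!nx0; apply: upS.
have x0r : x0 != r by rewrite eq_sym.
have fne y : y != x0 -> a != f y.
  by move=> y0; apply: contraNneq aS => ->; apply: imset_f; rewrite nx0.
have fI' y z : y != x0 -> z != x0 -> f y = f z -> y = z by rewrite -!nx0; apply: fI.
have pL y : y \in L -> par y != x0.
  move=> yL; have yr : y != r by case/andP: (leaves_leaf yL).
  exact: leaf_par.
have parI : {in L &, injective (f \o par)}.
  by move=> y z yL zL /fI' E; apply: (par_inj_leaves yL zL); apply: E; apply: pL.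
have fIL (Y : {set V}) : Y \subset L :\ x0 -> {in Y &, injective f}.
  by move=> /subsetP YL y z /YL/setD1P[y0 _] /YL/setD1P[z0 _]; apply: fI'.
right=> b1 b1b; set B1 := b1 |: B.
have B1e c : c \in B1 -> #|c| = 2.
  by move=> /setU1P[->|/(subsetP BB) cb]; apply/eqP; [move: b1b|move: cb]; rewrite inE.
have cB1 : #|B1| <= n - 2 + 1.
  by rewrite cardsU1 addnC leq_add ?leq_b1.
have n2 : 2 <= n.
  have := max_card (pred2 a (f r)); rewrite card_ord card2 fne //.
have deg1 z : edeg B z <= q -> edeg B1 z <= q.+1.
  by move=> H; apply: leq_trans (edeg_add1 _ _ _) _.
have heavy : #|[set z | q.+2 <= edeg B1 z]| < q.
  rewrite -(ltn_pmul2l (ltn0Sn q.+1)); apply: leq_ltn_trans (card_heavy _ B1e) _.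
  by apply: leq_ltn_trans (leq_mul (leqnn 2) cB1) _; clear -n2 nq; lia.
have [x xL xbad] : exists2 x, x \in L & x \notin x0 |:
   ([set x in L | [set a; (f \o par) x] \in B1] :|:
    [set x in L :\ x0 | f x \in [set z | q.+2 <= edeg B1 z]]).
  apply: exists_notin; apply: leq_ltn_trans bigL.
  apply: leq_trans (_ : 1 + (q.+1 + q) <= _); last by clear; lia.
  rewrite cardsU1 leq_add ?leq_b1 //; apply: leq_trans (leq_card_setU _ _).1 _.
  apply: leq_add; first by apply: leq_trans (card_nbrs_le _ _ parI) (deg1 _ dega).
  apply: leq_trans (ltnW heavy); rewrite -(card_in_imset (f := f)).
    by apply/subset_leq_card/subsetP => _ /imsetP[y + ->]; rewrite !inE => /andP[].
  by apply: fIL; apply/subsetP => y; rewrite inE => /andP[].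
move: xbad; rewrite in_setU1 in_setU negb_or negb_or 2![x \in [set _ in _ | _]]inE.
rewrite in_setD1 xL andbT /= => /and3P[xx0 afx]; rewrite xx0 inE /= -ltnNge => Xlight.
have xr : x != r by case/andP: (leaves_leaf xL).
exists [set a; f (par x)]; split=> //; first by rewrite in_board fne ?pL.
set M1 := _ |: M; right=> b2 b2b; set B2 := b2 |: B1.
have deg2 z : edeg B1 z <= q.+1 -> edeg B2 z <= q.+2.
  by move=> H; apply: leq_trans (edeg_add1 _ _ _) _.
have [z zL zbad] : exists2 z, z \in L & z \notin [set x; x0] :|:
   ([set z in L | [set a; (f \o par) z] \in B2] :|:
    ([set z in L | [set f x; (f \o par) z] \in B2] :|:
     [set z in L :\ x0 | [set f (par x0); f z] \in B2])).
  apply: exists_notin; apply: leq_ltn_trans bigL.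
  apply: leq_trans (_ : 2 + (q.+2 + (q.+2 + q.+2)) <= _); last by clear; lia.
  apply: leq_trans (leq_card_setU _ _).1 _; rewrite cards2 xx0; apply: leq_add => //.
  apply: leq_trans (leq_card_setU _ _).1 _; apply: leq_add.
    by apply: leq_trans (card_nbrs_le _ _ parI) (deg2 _ (deg1 _ dega)).
  apply: leq_trans (leq_card_setU _ _).1 _; apply: leq_add.
    by apply: leq_trans (card_nbrs_le _ _ parI) (deg2 _ _).
  apply: leq_trans (card_nbrs_le _ _ (fIL _ _)) (deg2 _ (deg1 _ degp)).
  exact: subxx.
move: zbad; rewrite !in_setU !negb_or 3![z \in [set _ in _ | _]]inE.
rewrite !in_set1 in_setD1 zL andbT /=.
case/and4P=> /andP[zx zx0] aWb XWb; rewrite zx0 /= => pZb.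
have zr : z != r by case/andP: (leaves_leaf zL).
exists [set f z; f (par x0)]; split.
- rewrite in_board; apply/eqP => /(fI' _ _ zx0 (pL _ x0L)) /eqP.
  by rewrite eq_sym (negbTE (leaf_par zL x0r)).
- by rewrite [[set f z; _]]setUC.
set M2 := _ |: M1; right=> b3 b3b.
have Mold y c : y != r -> y != x0 -> [set f y; f (par y)] \in c |: M2.
  by move=> yr y0; rewrite !in_setU1 fM ?nx0 ?orbT.
have f0I : injective (upd f x0 a).
  move=> y y'; rewrite /upd; case: (y =P x0) => [->|/eqP yn]; case: (y' =P x0) => [->|/eqP yn'] //.
  - by move=> E; have := fne _ yn'; rewrite E eqxx.
  - by move=> E; have := fne _ yn; rewrite E eqxx.
  exact: fI'.
have sE1 g u v : swap g u v u = g v :> 'I_n by rewrite /swap upd_eq.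
have sE2 g u v : v != u -> swap g u v v = g u :> 'I_n.
  by move=> vu; rewrite /swap upd_neq // upd_eq.
have sE3 g u v y : y != u -> y != v -> swap g u v y = g y :> 'I_n.
  by move=> yu yv; rewrite /swap !upd_neq.
have e0 y : y != x0 -> upd f x0 a y = f y by apply: upd_neq.
have x0z : x0 != z by rewrite eq_sym.
have xz : x != z by rewrite eq_sym.
have W0 := pL z zL; have Wz : par z != z by exact: leaf_par.
have Pz : par x0 != z by exact: leaf_par.
have Px : par x0 != x by exact: leaf_par.
have Wx : par z != x by exact: leaf_par.
have Yz : par x != z by exact: leaf_par.
have Yx : par x != x by exact: leaf_par.
have Y0 := pL x xL; have P0 := pL x0 x0L.
case: (eqVneq [set a; f (par z)] b3) => [E|NE].
  exists [set f x; f (par z)]; split.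
  - by rewrite in_board; apply/eqP => /(fI' _ _ xx0 W0) /eqP; rewrite eq_sym (negbTE Wx).
  - rewrite in_setU1 negb_or XWb andbT -E; apply/eqP => /setP /(_ a).
    by rewrite !inE eqxx (negbTE (fne _ xx0)) (negbTE (fne _ W0)).
  apply: (@win_copy (swap (swap (upd f x0 a) x0 x) x0 z) 0 set0).
    by do 2!apply: swap_inj.
  move=> y yr; have yz := leaf_par zL yr; have yx := leaf_par xL yr; have y0 := leaf_par x0L yr.
  rewrite [swap _ x0 z (par y)]sE3 // [swap _ x0 x (par y)]sE3 // (e0 (par y)) //.
  case: (eqVneq y x0) => [->|y0']; first by rewrite sE1 sE3 ?e0 // !inE eqxx !orbT.
  case: (eqVneq y z) => [->|yz']; first by rewrite sE2 // sE1 e0 // !inE eqxx.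
  case: (eqVneq y x) => [->|yx'].
    by rewrite sE3 // sE2 // upd_eq !inE eqxx !orbT.
  by rewrite !sE3 // e0 // Mold.
exists [set a; f (par z)]; split.
- by rewrite in_board fne.
- by rewrite in_setU1 negb_or NE.
apply: (@win_copy (swap (upd f x0 a) x0 z) 0 set0); first exact: swap_inj.
move=> y yr; have yz := leaf_par zL yr; have y0 := leaf_par x0L yr.
rewrite [swap _ x0 z (par y)]sE3 // (e0 (par y)) //.
case: (eqVneq y x0) => [->|y0']; first by rewrite sE1 e0 // !inE eqxx !orbT.
case: (eqVneq y z) => [->|yz']; first by rewrite sE2 // upd_eq !inE eqxx.
by rewrite sE3 // e0 // Mold.
Qed.

(** A play of the matching game between unused vertices and parents of missing
    leaves is a play of the embedding game.  The bound [q] includes the degrees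
    that Breaker can still add, as the last pair must satisfy it at the end. *)
Lemma matching_wins_wins q k f S B M :
    embeds f S M -> ~: S \subset L -> #|~: S| = k.+1 -> B \subset board ->
    #|B| + k + 2 <= n ->
    (forall a, a \notin f @: S -> edeg B a + k <= q) ->
    (forall x, x \notin S -> edeg B (f (par x)) + k <= q) ->
    2 * n < q.+2 * q -> 3 * q + 8 < #|L| -> #|V| = n ->
    matching_wins k (~: (f @: S)) (f @: (par @: ~: S)) B ->
  win (k + 3) B M.
Proof.
elim: k f S B M => [|k IH] f S B M emb SL cS BB cB dega degp nq bigL cV.
  move=> _; have [[rS upS] fI fM] := emb.
  have /cards1P[x0 x0E] : #|~: S| == 1 by rewrite cS.
  have SE : S = ~: [set x0] by rewrite -x0E setCK.
  have x0S : x0 \notin S by rewrite -in_setC x0E inE.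
  have /set0Pn[a aS] : ~: (f @: S) != set0.
    rewrite -card_gt0 cardsCs setCK card_in_imset // card_ord.
    have := cardsC S; rewrite cS; lia.
  rewrite inE in aS; rewrite SE in emb aS.
  apply: (@last_vertex q f x0 a) => //.
  - by apply: (subsetP SL); rewrite x0E inE.
  - lia.
  - by rewrite -[edeg _ _]addn0; apply: dega; rewrite SE.
  - by rewrite -[edeg _ _]addn0; apply: degp.
move=> mw; right=> b bb.
have [[rS upS] fI fM] := emb.
have [a [p [+ /imsetP[_ /imsetP[x xS ->] pE] ap mw']]] := mw b.
rewrite !inE in xS * => aS.
have xL : x \in L by apply: (subsetP SL); rewrite inE.
have xr : x != r by case/andP: (leaves_leaf xL).
have pS y : y \notin S -> par y \in S.
  move=> yS; have yr : y != r by apply: contraNneq yS => ->.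
  apply: contraT => pyS; have := @leaf_par (par y) y.
  by rewrite (subsetP SL) ?inE // => /(_ isT yr); rewrite eqxx.
exists [set a; p]; split=> //.
  rewrite in_board; apply: contraNneq aS => ->; rewrite pE imset_f ?pS //.
have emb' := embeds_upd emb xS (pS x xS) aS.
have fS' : upd f x a @: (x |: S) = a |: f @: S.
  by rewrite imsetU1 upd_eq imset_upd.
have sCS : ~: (x |: S) \subset ~: S by rewrite setCS subsetUr.
rewrite pE; apply: (IH _ _ _ _ emb') => //.
- exact: subset_trans sCS SL.
- have := cardsC (x |: S); have := cardsC S; rewrite cardsU1 xS; clear -cS; lia.
- by rewrite subUset sub1set bb.
- have : #|b |: B| <= #|B|.+1 by rewrite cardsU1 -add1n leq_add ?leq_b1.
  clear -cB; lia.
- move=> a'; rewrite fS' in_setU1 negb_or => /andP[_ /dega].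
  have := edeg_add1 b B a'; clear; lia.
- move=> y; rewrite in_setU1 negb_or => /andP[yx yS].
  rewrite upd_neq; last by apply: contraNneq xS => <-; apply: pS.
  have := edeg_add1 b B (f (par y)); have := degp y yS; clear; lia.
have -> : ~: (upd f x a @: (x |: S)) = ~: (f @: S) :\ a.
  by rewrite fS'; apply/setP => z; rewrite !inE negb_or.
suff -> : upd f x a @: (par @: ~: (x |: S)) = f @: (par @: ~: S) :\ p by [].
have -> : ~: S = x |: ~: (x |: S).
  by apply/setP => y; rewrite !inE; case: eqP => [->|].
rewrite !imsetU1 -pE imset_upd; last first.
  apply/imsetP => -[y yS E]; move: xS; rewrite E pS //.
  by move: yS; rewrite !inE negb_or => /andP[].
rewrite setU1K // pE; apply/imsetP => -[_ /imsetP[y yS ->]].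
move: yS; rewrite !inE negb_or => /andP[yx yS].
move=> /fI; rewrite !pS // => /(_ isT isT) /(par_inj_leaves xL).
by rewrite (subsetP SL) ?inE // => /(_ isT) E; rewrite E eqxx in yx.
Qed.

End Embedding.

(** * Embedding the tree under control of Breaker's degrees *)

Section Growing.
Variables (V : finType) (e : rel V) (r : V) (par : V -> V) (d : V -> nat).
Hypotheses (e_sym : symmetric e) (rt : rooted e r par d).
Variable Delta : nat.
Hypothesis degD : forall x, degree e x <= Delta.
Variable n : nat.
Hypothesis cV : #|V| = n.
Implicit Types (f : V -> 'I_n) (S : {set V}) (B M : {set {set 'I_n}}).
Local Notation board := (complete_edges n).
Local Notation win := (wins board (tree_copies e n)).
Local Notation L := (leaves r par).
Local Notation children := (children r par).
Local Notation opens := (opens r par).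
Local Notation upclosed := (upclosed r par).
Local Notation embeds := (embeds r par).

Variable tau : nat.

(** At the image of a closed vertex Maker needs no further edge, so Breaker's
    edges there are harmless. *)
Definition alive f S : {set 'I_n} := ~: (f @: (S :\: opens S)).

(** An upper bound for the number of moves spent on heavy vertices, which depends
    on the position only: at most two for embedding a heavy vertex and one for
    each child embedded below it.  It never decreases during the game. *)
Definition load f S B :=
  \sum_(x in S | tau <= edeg B (f x)) (2 + #|children x :&: S|).

Lemma load_le f S B : {in S &, injective f} ->
  load f S B <= #|[set z | tau <= edeg B z]| * Delta.+2.
Proof.
move=> fI; rewrite /load.
have -> : \sum_(x in S | tau <= edeg B (f x)) (2 + #|children x :&: S|) =
   \sum_(x in [set x in S | tau <= edeg B (f x)]) (2 + #|children x :&: S|).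
  by apply: eq_bigl => x; rewrite !inE.
apply: leq_trans (@sum_le_max _ _ _ Delta.+2 _) _.
  move=> x _; rewrite -(addn2 Delta) addnC leq_add2r.
  by apply: leq_trans (subset_leq_card (subsetIl _ _)) (card_children e_sym rt degD x).
rewrite leq_mul2r -(card_in_imset (f := f)) ?orbF.
  by apply/orP; right; apply/subset_leq_card/subsetP => _ /imsetP[x + ->]; rewrite !inE => /andP[].
by move=> x y; rewrite !inE => /andP[xS _] /andP[yS _]; apply: fI.
Qed.

Lemma load_sub f S B B' : B \subset B' -> load f S B <= load f S B'.
Proof.
move=> sBB; rewrite /load big_mkcondr [leqRHS]big_mkcondr; apply: leq_sum => x _.
case: ifP => // H; rewrite ifT //; apply: leq_trans H (edeg_sub _ sBB).
Qed.

(** Embedding a child of a heavy vertex raises the load by 1, and embedding a heavy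
    vertex raises it by 2. *)
Lemma load_upd f S B x a : x \notin S -> x != r ->
  par x \in S ->
  load f S B + (tau <= edeg B (f (par x))) + 2 * (tau <= edeg B a) <=
  load (upd f x a) (x |: S) B.
Proof.
move=> xS xr pS; rewrite /load [leqRHS]big_mkcondr big_setU1 //= upd_eq addnC.
apply: leq_add.
  by case: (tau <= _) => //; rewrite muln1 leq_addr.
rewrite big_mkcondr /= (bigD1 (par x)) //= [leqRHS](bigD1 (par x)) //= -addnA [X in _ + X <= _]addnC addnA.
have neq y : y \in S -> y != x by move=> yS; apply: contraNneq xS => <-.
apply: leq_add.
  rewrite upd_neq ?neq //; case: (tau <= _) => //; rewrite addn1.
  rewrite ltn_add2l; apply: proper_card; apply/properP; split.
    by apply: setIS; apply: subsetUr.
  by exists x; rewrite inE ?(negbTE xS) ?andbF // setU11 andbT; apply/childP.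
apply: leq_sum => y /andP[yS _]; rewrite upd_neq ?neq //.
case: (tau <= _) => //; rewrite leq_add2l.
by apply: subset_leq_card; apply: setIS; apply: subsetUr.
Qed.

Lemma alive_upd f S x a z : x \notin S ->
  z \in alive (upd f x a) (x |: S) -> z \in alive f S.
Proof.
move=> xS; rewrite !inE; apply: contra => /imsetP[y]; rewrite in_setD => /andP[yo yS] ->.
have yx : y != x by apply: contraNneq xS => <-.
apply/imsetP; exists y; last by rewrite upd_neq.
rewrite in_setD setU1r // andbT; apply: contra yo.
case/openP => _ [w [wS wr pw]]; apply/openP; split=> //; exists w; split=> //.
by apply: contra wS; apply: setU1r.
Qed.

Lemma aliveP f S z : {in S &, injective f} ->
  z \in alive f S -> z \notin f @: S \/ exists2 u, u \in opens S & z = f u.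
Proof.
move=> fI; rewrite inE => zd; case: (boolP (z \in f @: S)) => zS; [right|by left].
case/imsetP: zS zd => u uS -> ud; exists u => //.
by apply: contraR ud => uo; apply: imset_f; rewrite in_setD uo.
Qed.

Lemma avail_alive f S z : z \notin f @: S -> z \in alive f S.
Proof. by rewrite inE; apply: contra; apply/subsetP/imsetS/subsetDl. Qed.

Lemma open_alive f S u : {in S &, injective f} -> u \in opens S -> f u \in alive f S.
Proof.
move=> fI uo; have uS : u \in S by case/openP: uo.
rewrite inE; apply/imsetP => -[y]; rewrite in_setD => /andP[yo yS] /(fI _ _ uS yS) E.
by rewrite -E uo in yo.
Qed.

(** The number [s] counts the moves of Breaker which have not yet been answered.
    Reserved leaves are embedded only below or at heavy vertices, until nothing
    else is left; the successor is for the second vertex embedded at the start,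
    whose nature is not known. *)
Definition controlled s f S B M : Prop :=
  [/\ embeds f S M, B \subset board,
      forall z, z \in alive f S -> edeg B z <= tau + load f S B + s &
      ~: S \subset L \/ #|S :&: L| <= (load f S B).+1].

Lemma controlled_breaker s f S B M b : controlled s f S B M -> b \in board ->
  controlled s.+1 f S (b |: B) M.
Proof.
case=> emb BB deg leafc bb; have ld := load_sub f S (subsetUr [set b] B).
split=> //.
- by rewrite subUset sub1set bb.
- by move=> z /deg; have := edeg_add1 b B z; lia.
by case: leafc => [|le]; [left|right; lia].
Qed.

Lemma controlled_sub s f S B M M' : M \subset M' -> controlled s f S B M -> controlled s f S B M'.
Proof. by move=> MM [emb ? ? ?]; split=> //; apply: embedsW emb. Qed.

(** A move that raises the load by [g] answers [g] moves of Breaker. *)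
Lemma controlled_upd s g f S B M x a : controlled s f S B M -> x \notin S -> par x \in S ->
  a \notin f @: S ->
  g <= (tau <= edeg B (f (par x))) + 2 * (tau <= edeg B a) ->
  [\/ x \notin L, 0 < g | ~: S \subset L] ->
  controlled (s - g) (upd f x a) (x |: S) B ([set a; f (par x)] |: M).
Proof.
case=> emb BB deg leafc xS pS aS gain xcase.
have xr : x != r by apply: contraNneq xS => ->; case: emb => -[].
have {gain} ld : load f S B + g <= load (upd f x a) (x |: S) B.
  by apply: leq_trans (load_upd f B a xS xr pS); rewrite -addnA leq_add2l.
split=> //; first exact: embeds_upd.
- by move=> z /alive_upd-/(_ xS)/deg; lia.
have sC : ~: (x |: S) \subset ~: S by rewrite setCS subsetUr.
case: leafc => [SL|le]; first by left; apply: subset_trans SL.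
have le1 : #|(x |: S) :&: L| <= (x \in L) + #|S :&: L|.
  apply: leq_trans (_ : #|([set x] :&: L) :|: (S :&: L)| <= _).
    by rewrite -setIUl.
  apply: leq_trans (leq_card_setU _ _).1 _; rewrite leq_add2r.
  case: (boolP (x \in L)) => xL; first by rewrite /= -(cards1 x) subset_leq_card ?subsetIl.
  by rewrite leqn0 cards_eq0 setI_eq0 disjoints1.
case: xcase => [xL|g0|SL]; last by left; apply: subset_trans SL.
  by right; move: le1; rewrite (negbTE xL); clear -le ld; lia.
by right; have := leq_b1 (x \in L); clear -le le1 ld g0; lia.
Qed.

(** When no alive vertex is heavy, every move is an answer. *)
Lemma controlled_calm s f S B M : controlled s f S B M ->
  (forall z, z \in alive f S -> edeg B z <= tau) -> controlled 0 f S B M.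
Proof.
by case=> emb BB _ lc calm; split=> // z /calm; lia.
Qed.


Variable m2 : nat.
Hypotheses (m20 : 0 < m2) (nobare : ~ has_bare_path e m2).
Variables (c2 : V) (Q : {set V}).
Hypotheses (c2Q : c2 \in Q) (rQ : r \notin Q).
Hypothesis cross_Q : forall x y, x \in Q -> y \notin Q -> e x y -> x = c2 /\ y = r.

(** [C0] is the constant of [card_opens].  A position is early when [S] has at
    most [N1] vertices: beyond that [2 * tau] vertices are open, and until then
    each side of the starting edge has a deep slot. *)
Let C0 := Delta.+2 * (m2.+1 * Delta.+1 ^ m2).
Let N1 := (3 * C0 + 1) * tau.

Hypotheses (bigQ : Delta.+1 * N1 < #|Q|) (bigCQ : Delta.+1 * N1 < #|~: Q|).
Hypothesis few_heavy : forall h, tau * h <= 2 * n -> h * Delta.+2 + 2 <= tau.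
Hypothesis bigL : 3 * (9 * tau) + 8 < #|L|.
Hypothesis n_tau : 2 * n < (9 * tau).+2 * (9 * tau).
Variable K : nat.
Hypotheses (K0 : 0 < K) (nK : n <= K * (3 * tau)).
Hypothesis K_tau : 2 ^ K * (K.+1 * K.+1 + K + 3) < 3 * tau.
Hypothesis bign : N1 + 6 * tau + 2 <= n.

Lemma tau_gt2 : 2 < tau.
Proof. have := @few_heavy 1; have := bign; rewrite muln1 mul1n; lia. Qed.

(** There are few heavy vertices, each with a load of at most [Delta + 2]. *)
Lemma load_cap s f S B M : controlled s f S B M -> #|B| <= n -> load f S B + 2 <= tau.
Proof.
case=> -[_ fI _] BB _ _ cB; have := load_le B fI.
have B2 c : c \in B -> #|c| = 2 by move=> /(subsetP BB); rewrite inE => /eqP.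
have := @few_heavy #|[set z | tau <= edeg B z]|; have := card_heavy tau B2; lia.
Qed.

Lemma card_avail f S : {in S &, injective f} -> #|~: (f @: S)| = #|~: S|.
Proof.
move=> fI; have := cardsC S; have := cardsC (f @: S).
rewrite card_in_imset // card_ord; lia.
Qed.

Lemma leaves_avail f S B M s : controlled s f S B M -> #|B| <= n -> #|~: S| <= 7 * tau ->
  ~: S \subset L.
Proof.
move=> I cB cS; have := load_cap I cB; case: I => _ _ _ [//|le] ld.
have : #|L| <= #|S :&: L| + #|~: S|.
  rewrite -(cardsID S L) setIC leq_add2l; apply/subset_leq_card/subsetP => x.
  by rewrite !inE => /andP[].
have := bigL; lia.
Qed.

Lemma par_in_of_leaves S : upclosed S -> ~: S \subset L -> forall x, x \notin S -> par x \in S.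
Proof.
move=> [rS _] SL x xS; have xr : x != r by apply: contraNneq xS => ->.
apply: contraT => pS; have := @leaf_par _ r par (par x) x.
by rewrite (subsetP SL) ?inE // => /(_ isT xr); rewrite eqxx.
Qed.

(** When [6 * tau] vertices are missing they are all reserved leaves, and the
    matching game is played with degrees at most [2 * tau].  The bound
    [9 * tau] covers the [6 * tau] edges that Breaker adds meanwhile. *)
Lemma controlled_win_leaves f S B M : controlled 0 f S B M -> #|B| < #|S| -> #|~: S| = 6 * tau ->
  win (6 * tau + 2) B M.
Proof.
move=> I BS cS; have cSC := cardsC S; have cB : #|B| <= n by lia.
have t2 := tau_gt2.
have SL : ~: S \subset L by apply: leaves_avail I cB _; lia.
have ld := load_cap I cB; case: (I) => emb BB deg _; have [upS fI fM] := emb.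
have pS := par_in_of_leaves upS SL.
have deg2 z : z \in alive f S -> edeg B z <= 2 * tau by move=> /deg; lia.
have rS : r \in S by case: upS.
have opn x : x \notin S -> par x \in opens S.
  move=> xS; apply/openP; split; first exact: pS.
  by exists x; split=> //; apply: contraNneq xS => ->.
have cP : #|f @: (par @: ~: S)| = #|~: S|.
  rewrite card_in_imset => [|x y /imsetP[x' xS ->] /imsetP[y' yS ->]]; last first.
    by apply: fI; apply: pS; rewrite -in_setC.
  rewrite card_in_imset // => x y xS yS.
  by apply: par_inj_leaves; apply: (subsetP SL).
have cA := card_avail fI.
have -> : 6 * tau + 2 = (6 * tau).-1 + 3 by lia.
apply: (@matching_wins_wins _ e r par d rt n (9 * tau) _ f S) => //;
  try by clear -t2 cS BS cSC cV; lia.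
- by move=> a /(@avail_alive f S)/deg2; clear -t2; lia.
- by move=> x /opn/(open_alive fI)/deg2; clear -t2; lia.
apply: (@matching_wins_capped_degree _ K (2 * tau) (3 * tau)) => //;
  try by rewrite ?cP ?cA ?cS; clear -t2 K_tau; lia.
- rewrite disjoint_subset; apply/subsetP => z; rewrite !inE; apply: contra.
  case/imsetP=> _ /imsetP[x xS ->] ->; apply: imset_f; apply: pS.
  by rewrite -in_setC.
- move=> z; apply: edeg_cross_le => {}z /setUP[zA|/imsetP[_ /imsetP[x xS ->] ->]].
    by apply/deg2/avail_alive; rewrite -in_setC.
  by apply/deg2/open_alive => //; apply: opn; rewrite -in_setC.
- apply: leq_trans (subset_leq_card (subsetIl _ _)) _.
  by apply: leq_trans (leq_trans cB nK) _; rewrite leq_mul2l; apply/orP; right; lia.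
Qed.

(** Few reserved leaves are in [S], so [card_opens] applies to the rest; when only
    reserved leaves are missing, their parents are all open. *)
Lemma many_opens f S B M s : controlled s f S B M -> #|B| <= n ->
  N1 < #|S| -> 6 * tau < #|~: S| -> 2 * tau < #|opens S|.
Proof.
move=> I cB bigS cS; have ld := load_cap I cB; have t2 := tau_gt2.
case: I => -[upS fI fM] BB deg lc; have [rS upS'] := upS.
case: lc => [SL|le].
  suff : #|~: S| <= #|opens S| by lia.
  rewrite -(card_in_imset (f := par)); last first.
    by move=> x y /(subsetP SL) xL /(subsetP SL) yL; apply: (par_inj_leaves xL yL).
  apply/subset_leq_card/subsetP => _ /imsetP[x xS ->]; rewrite inE in xS.
  apply/openP; split; first exact: par_in_of_leaves.
  by exists x; split=> //; apply: contraNneq xS => ->.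
have upSL : upclosed (S :\: L).
  split=> [|x /setDP[xS xL]]; apply/setDP.
    by split=> //; apply/negP => /leaves_leaf; rewrite /leaf eqxx.
  case: (eqVneq x r) => [xr|xr]; first by rewrite xr in xS xL *; rewrite (par_root rt).
  by split; [apply: upS'|apply/negP => pL; have := leaf_par pL xr; rewrite eqxx].
have V1 : 1 < #|V| by rewrite cV; lia.
have dis : [disjoint S :\: L & L].
  by rewrite disjoint_subset; apply/subsetP => x /setDP[].
have := card_opens e_sym rt degD m20 nobare V1 upSL dis.
have : #|opens (S :\: L)| <= #|opens S| + #|S :&: L|.
  apply: (@leq_trans #|opens S :|: par @: (S :&: L)|).
    apply/subset_leq_card/subsetP => u /openP[/setDP[uS _] [x [xSL xr pu]]].
    apply/setUP; case: (boolP (x \in S)) => xS; [right|left].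
      apply/imsetP; exists x => //; apply/setIP; split=> //.
      by apply: contraNT xSL => xL; apply/setDP.
    by apply/openP; split=> //; exists x.
  by rewrite (leq_trans (leq_card_setU _ _).1) // leq_add2l leq_imset_card.
rewrite -/C0; have := cardsID L S; move: bigS; rewrite /N1.
move: le ld t2; move: #|opens _| #|opens _| #|_ :&: _| #|_ :\: _| #|S| C0 => a b c x y z.
move=> le ld t2 H1 H2 H3 H4; rewrite ltnNge; apply/negP => bt.
have : z * b <= z * (3 * tau) by rewrite leq_mul2l; apply/orP; right; lia.
lia.
Qed.

(** The two places are distinct since they lie on different sides of the edge
    between [r] and [c2], both ends of which belong to [S]. *)
Lemma two_deep_slots S : upclosed S -> c2 \in S -> #|S| <= N1 ->
  exists u1 x1 y1 u2 x2 y2,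
  [/\ [/\ u1 \in opens S, x1 \notin S, y1 \notin S, par x1 = u1 & par y1 = x1],
      [/\ u2 \in opens S, x2 \notin S, y2 \notin S, par x2 = u2 & par y2 = x2] & u1 != u2].
Proof.
move=> upS c2S cS; have [rS _] := upS.
have nr z : z \notin S -> z != r by apply: contraNneq => ->.
have le : Delta.+1 * #|S| <= Delta.+1 * N1 by rewrite leq_mul2l cS orbT.
have up1 z : z \in Q -> z \notin S -> par z \in Q.
  move=> zQ zS; apply: contraT => pQ.
  by have [E _] := cross_Q zQ pQ (par_edge rt (nr z zS)); rewrite E c2S in zS.
have up2 z : z \in ~: Q -> z \notin S -> par z \in ~: Q.
  rewrite !inE => zQ zS; apply/negP => pQ.
  have := cross_Q pQ zQ; rewrite e_sym => /(_ (par_edge rt (nr z zS)))[_ E].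
  by rewrite E rS in zS.
have [u1 [x1 [y1 [[u1i x1S y1S [x1r _]] [p1 q1]]]]] :=
  deep_slot e_sym rt degD upS up1 (leq_ltn_trans le bigQ).
have [u2 [x2 [y2 [[u2i x2S y2S [x2r _]] [p2 q2]]]]] :=
  deep_slot e_sym rt degD upS up2 (leq_ltn_trans le bigCQ).
case/setIP: u1i => u1S u1Q; case/setIP: u2i => u2S; rewrite inE => u2Q.
exists u1, x1, y1, u2, x2, y2; split.
- by split=> //; apply/openP; split=> //; exists x1.
- by split=> //; apply/openP; split=> //; exists x2.
by apply: contraNneq u2Q => <-.
Qed.

(** Ancestors of a vertex are not leaves, so the topmost missing ancestor of a
    missing vertex outside [L] is again outside [L]. *)
Lemma next_vertex S : upclosed S -> ~: S != set0 ->
  exists x, [/\ x \notin S, par x \in S & x \notin L \/ ~: S \subset L].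
Proof.
move=> upS; have [rS _] := upS; case: (boolP (~: S \subset L)) => [SL /set0Pn[x]|/subsetPn[z]].
  by rewrite inE => xS; exists x; split=> //; [apply: par_in_of_leaves|right].
rewrite inE => zS zL _; have [k] := ubnP (d z); elim: k z zS zL => [//|k IH] z zS zL dk.
have zr : z != r by apply: contraNneq zS => ->.
case: (boolP (par z \in S)) => pS; first by exists z; split=> //; left.
apply: (IH (par z)) => //; last by have := par_depth rt zr; lia.
by apply/negP => pL; have := leaf_par pL zr; rewrite eqxx.
Qed.


Lemma cardsC_add S x : x \notin S -> #|~: S| = (#|~: (x |: S)|).+1.
Proof. by move=> xS; have := cardsC S; have := cardsC (x |: S); rewrite cardsU1 xS; lia. Qed.

Lemma board_new f S x a : par x \in S -> a \notin f @: S -> [set a; f (par x)] \in board.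
Proof. by move=> pS aS; rewrite in_board; apply: contraNneq aS => ->; apply: imset_f. Qed.

(** Maker's rules, in order of priority: embed a child of a heavy open vertex;
    embed a heavy unused vertex, directly or, early in the game, in two moves;
    embed any next vertex. *)
Lemma controlled_win f S B M : controlled 0 f S B M -> c2 \in S -> #|B| < #|S| ->
  6 * tau <= #|~: S| -> win (#|~: S| + 2) B M.
Proof.
have [k] := ubnP #|~: S|; elim: k f S B M => [//|k IH] f S B M Sk I c2S BS.
rewrite leq_eqVlt => /orP[/eqP cS|cS]; first by rewrite -cS; apply: controlled_win_leaves I BS _.
have t2 := tau_gt2; have cSC := cardsC S; rewrite cV in cSC.
rewrite addn2 -addn1; right=> b bb.
have cbB : #|b |: B| <= #|B|.+1 by rewrite cardsU1 -add1n leq_add ?leq_b1.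
have I1 := controlled_breaker I bb; move: I1 cbB; set B1 := b |: B => I1 cB1.
have cB1n : #|B1| <= n by clear -cB1 BS cSC; lia.
have ld := load_cap I1 cB1n; case: (I1) => emb B1b deg lc; have [upS fI fM] := emb.
have deg2 z : z \in alive f S -> edeg B1 z <= 2 * tau by move=> /deg; clear -ld; lia.
have cA := card_avail fI.
have move x a (I' : controlled 0 (upd f x a) (x |: S) B1 ([set a; f (par x)] |: M)) :
    x \notin S -> par x \in S -> a \notin f @: S -> [set a; f (par x)] \notin B1 ->
    exists m, [/\ m \in board, m \notin B1 & win (#|~: S| + 1) B1 (m |: M)].
  move=> xS pS aS aB; exists [set a; f (par x)]; split=> //; first exact: board_new pS aS.
  have cx := cardsC_add xS.
  have -> : #|~: S| + 1 = #|~: (x |: S)| + 2 by rewrite cx addn1 addn2.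
  apply: IH I' _ _ _.
  - by move: Sk; rewrite cx.
  - by rewrite setU1r.
  - by rewrite cardsU1 xS; clear -cB1 BS; lia.
  - by rewrite -ltnS -cx.
have avail u : u \in opens S -> exists2 a, a \notin f @: S & [set a; f u] \notin B1.
  move=> uo; have [||a aA aB] := @free_nbr _ _ id (~: (f @: S)) B1 (f u).
  - by move=> ? ? _ _.
  - by rewrite cA; apply: leq_ltn_trans (deg2 _ (open_alive fI uo)) _; apply: leq_ltn_trans cS; rewrite leq_mul2r orbT.
  by exists a; [rewrite -in_setC|rewrite setUC].
case: (boolP [exists u in opens S, tau <= edeg B1 (f u)]) => [/existsP[u /andP[uo hu]]|calm1].
  have [a aS aB] := avail u uo; case/openP: uo => uS [x [xS xr pu]].
  apply: (move x a) => //; rewrite ?pu //.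
  have := @controlled_upd 1 1 f S B1 M x a I1 xS _ aS.
  by rewrite pu hu; apply=> //; apply: Or32.
case: (boolP [exists v in ~: (f @: S), tau <= edeg B1 v]) => [/existsP[v /andP[vA hv]]|calm2].
  rewrite inE in vA.
  case: (ltnP (2 * tau) #|opens S|) => [many|few].
    have [||u uo uB] := @free_nbr _ _ f (opens S) B1 v.
    - by move=> x y /openP[xS _] /openP[yS _]; apply: fI.
    - by apply: leq_ltn_trans many; apply/deg2/avail_alive.
    case/openP: uo => uS [x [xS xr pu]].
    apply: (move x v) => //; rewrite ?pu //.
    have := @controlled_upd 1 1 f S B1 M x v I1 xS _ vA.
    rewrite pu hv; apply=> //; last by apply: Or32.
    by rewrite muln1 addn2.
  (* Breaker may have separated v from all open vertices, but not from a fresh w,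
     which is free from v and from two vertices with deep slots *)
  have cS1 : #|S| <= N1.
    by rewrite leqNgt; apply/negP => bigS; have := many_opens I1 cB1n bigS cS; rewrite ltnNge few.
  have [u1 [x1 [y1 [u2 [x2 [y2 [[u1o x1S y1S p1 q1] [u2o x2S y2S p2 q2] u12]]]]]]] :=
    two_deep_slots upS c2S cS1.
  have u1S : u1 \in S by case/openP: u1o.
  have u2S : u2 \in S by case/openP: u2o.
  have nbrs z : z \in alive f S -> #|[set w in setT | [set z; w] \in B1]| <= 2 * tau.
    by move=> /deg2; apply: leq_trans (@card_nbrs_le _ _ id _ _ _ (in2W (@inj_id _))).
  have [w wA wbad] : exists2 w, w \in ~: (f @: S) & w \notin v |:
      ([set w in setT | [set v; w] \in B1] :|: ([set w in setT | [set f u1; w] \in B1] :|: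
        [set w in setT | [set f u2; w] \in B1])).
    apply: exists_notin; rewrite cA.
    apply: (@leq_ltn_trans (1 + (2 * tau + (2 * tau + 2 * tau)))); last by have := bign; clear -cS1 cSC; lia.
    rewrite cardsU1 leq_add ?leq_b1 //.
    apply: leq_trans (leq_card_setU _ _).1 _; apply: leq_add;
      last (apply: leq_trans (leq_card_setU _ _).1 _; apply: leq_add).
    - exact/nbrs/avail_alive.
    - exact/nbrs/open_alive.
    - exact/nbrs/open_alive.
  move: wbad; rewrite in_setU1 2!in_setU 3![w \in [set _ in _ | _]]inE in_setT /= !negb_or.
  rewrite inE in wA; case/and4P=> wv vwB u1wB u2wB.
  exists [set v; w]; split=> //; first by rewrite in_board eq_sym.
  rewrite addn1 -[X in wins _ _ X.+1]addn0; right=> b2 b2b; set B2 := b2 |: B1; set M1 := _ |: M.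
  have I2 : controlled 2 f S B2 M1 by apply: controlled_breaker b2b; apply: controlled_sub I1; apply: subsetUr.
  have cB2 : #|B2| <= #|B1|.+1 by rewrite cardsU1 -add1n leq_add ?leq_b1.
  have [u [x [y [[uo xS yS pu qx] uwB]]]] : exists u x y,
      [/\ u \in opens S, x \notin S, y \notin S, par x = u & par y = x] /\ [set f u; w] \notin B2.
    case: (eqVneq [set f u1; w] b2) => [E|NE].
      exists u2, x2, y2; split=> //; rewrite in_setU1 negb_or u2wB andbT -E.
      apply: contraNneq u12; rewrite setUC [[set f u1; w]]setUC => /set2_injr E'.
      by apply/eqP/esym/fI.
    by exists u1, x1, y1; split=> //; rewrite in_setU1 negb_or NE.
  have uS : u \in S by case/openP: uo.
  have rS : r \in S by case: upS.
  have xr : x != r by apply: contraNneq xS => ->.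
  have yr : y != r by apply: contraNneq yS => ->.
  have yx : y != x by apply/eqP => E; have := par_neq rt yr; rewrite qx E eqxx.
  have hv2 : tau <= edeg B2 v by apply: leq_trans hv (edeg_sub _ (subsetUr _ _)).
  exists [set w; f u]; split.
  - by rewrite -pu; apply: board_new wA; rewrite pu.
  - by rewrite setUC.
  have xL : x \notin L by apply/negP => xL; have := leaf_par xL yr; rewrite qx eqxx.
  have := @controlled_upd 2 0 f S B2 M1 x w I2 xS _ wA (leq0n _) (Or31 _ _ xL).
  rewrite pu => /(_ uS) I3.
  have fS' : upd f x w @: (x |: S) = w |: f @: S by rewrite imsetU1 upd_eq imset_upd.
  have yS' : y \notin x |: S by rewrite in_setU1 negb_or yx.
  have pyS' : par y \in x |: S by rewrite qx setU11.
  have vA' : v \notin upd f x w @: (x |: S) by rewrite fS' in_setU1 negb_or eq_sym wv.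
  have := @controlled_upd (2 - 0) 2 _ _ _ _ y v I3 yS' pyS' vA' _ (Or32 _ _ isT).
  rewrite hv2 leq_addl => /(_ isT); rewrite qx upd_eq.
  have vwM : [set v; w] \in [set w; f u] |: M1 by rewrite !in_setU1 eqxx orbT.
  have -> : [set v; w] |: ([set w; f u] |: M1) = [set w; f u] |: M1.
    by apply/setUidPr; rewrite sub1set.
  move=> I4.
  have cx := cardsC_add xS; have cy := cardsC_add yS'.
  have -> : #|~: S| + 0 = #|~: (y |: (x |: S))| + 2 by rewrite cx cy addn0 addn2.
  apply: IH I4 _ _ _.
  - by clear -Sk cx cy; lia.
  - by do 2!apply: setU1r.
  - by rewrite !cardsU1 yS' xS; clear -cB1 BS cB2; lia.
  - by have := bign; clear -cS1 cSC cx cy; lia.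
have calm z : z \in alive f S -> edeg B1 z < tau.
  case/(aliveP fI) => [zA|[u uo ->]]; rewrite ltnNge.
    by apply: contra calm2 => hz; apply/existsP; exists z; rewrite inE zA.
  by apply: contra calm1 => hz; apply/existsP; exists u; rewrite uo.
have [|x [xS pS xL]] := next_vertex upS; first by rewrite -card_gt0; apply: leq_ltn_trans cS.
have xr : x != r by apply: contraNneq xS => ->; case: upS.
have px : par x \in opens S by apply/openP; split=> //; exists x.
have [a aS aB] := avail _ px.
apply: (move x a) => //.
have I0 : controlled 0 f S B1 M by apply: controlled_calm I1 _ => z /calm/ltnW.
have := @controlled_upd 0 0 f S B1 M x a I0 xS pS aS (leq0n _).
by apply; case: xL => xL; [apply: Or31|apply: Or33].
Qed.

End Growing.

(** * Choice of the constants *)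

Lemma card_complete_edges n : 10 <= n -> 2 * (n + 1) <= #|complete_edges n|.
Proof.
move=> n10; rewrite /complete_edges card_draws card_ord bin2 -divn2 leq_divRL //.
have : n * 9 <= n * n.-1 by rewrite leq_mul2l; apply/orP; right; lia.
lia.
Qed.

Lemma other_edge n (b : {set 'I_n}) : 2 < n -> exists i j : 'I_n, i != j /\ [set i; j] != b.
Proof.
move=> n2; pose o k (H : k < n) := Ordinal H.
have [n0 n1] : 0 < n /\ 1 < n by lia.
case: (eqVneq [set o 0 n0; o 1 n1] b) => [E|]; last by exists (o 0 n0), (o 1 n1).
exists (o 0 n0), (o 2 n2); split=> //; rewrite -E; apply/eqP => /set2_injr.
by move=> /(congr1 val).
Qed.

(** The thresholds of the proof are multiples of the scale [tau = n %/ K], up to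
    constants; [K] is large compared with [Delta] and [C0], and [n] is so large that
    [tau] exceeds every constant. *)
Lemma scale_exists Delta C0 : 0 < Delta -> exists K n0, forall n, n0 <= n ->
  exists tau, [/\ 0 < K, 10 <= n, n <= K * (3 * tau) &
   2 ^ K * (K.+1 * K.+1 + K + 3) < 3 * tau] /\
  [/\ forall h, tau * h <= 2 * n -> h * Delta.+2 + 2 <= tau,
     forall l, n <= C0.+1 * l -> 3 * (9 * tau) + 8 < l,
     2 * n < (9 * tau).+2 * (9 * tau),
     (3 * C0 + 1) * tau + 6 * tau + 2 <= n &
     forall q, n <= 2 * (Delta * q) + 2 -> Delta.+1 * ((3 * C0 + 1) * tau) < q].
Proof.
move=> D0; pose D2 := Delta * (Delta.+1 * (3 * C0 + 1)).
pose K := 28 * C0.+1 + 2 * D2 + 3 * C0 + 20.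
pose X := 2 ^ K * (K.+1 * K.+1 + K + 3).
pose t0 := 4 * K * Delta.+2 + X + K + 10.
exists K, (K * t0) => n nt0.
have K0 : 0 < K by rewrite /K; lia.
exists (n %/ K); set t := n %/ K.
have tt0 : t0 <= t by rewrite leq_divRL // mulnC.
have tn : K * t <= n by rewrite mulnC leq_trunc_div.
have nt : n < K * t + K by have := ltn_ceil n K0; rewrite mulSn mulnC addnC.
have Kt : K <= K * t by rewrite leq_pmulr //; rewrite /t0 in tt0; lia.
have n2 : n < 2 * (K * t) by lia.
have t10 : 10 <= t by rewrite /t0 in tt0; lia.
split; split => //.
- by apply: leq_trans tn; apply: leq_trans t10 _; rewrite leq_pmull.
- by apply: ltnW; apply: leq_trans n2 _; rewrite mulnCA leq_mul2l; apply/orP; right; lia.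
- by rewrite -/X; rewrite /t0 in tt0; lia.
- move=> h th; have h4 : h < 4 * K.
    rewrite -(ltn_pmul2l (_ : 0 < t)); last by lia.
    by apply: leq_ltn_trans th _; lia.
  apply: (@leq_trans (4 * K * Delta.+2 + 2)); last by rewrite /t0 in tt0; lia.
  by rewrite leq_add2r leq_mul2r (ltnW h4) orbT.
- move=> l nl; rewrite ltnNge; apply/negP => l27.
  have : C0.+1 * l <= C0.+1 * (28 * t) by rewrite leq_mul2l; apply/orP; right; lia.
  have : 28 * C0.+1 * t < K * t by rewrite ltn_pmul2r; rewrite /K; lia.
  lia.
- have : 9 * K * (9 * t) <= (9 * t).+2 * (9 * t).
    by rewrite leq_mul2r; apply/orP; right; rewrite /t0 in tt0; lia.
  lia.
- have : (3 * C0 + 1) * t + 7 * t <= K * t.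
    by rewrite -mulnDl leq_mul2r; apply/orP; right; rewrite /K; lia.
  lia.
move=> q nq; rewrite ltnNge; apply/negP => q1.
have : 2 * (Delta * q) <= 2 * (D2 * t).
  rewrite leq_mul2l /= /D2 -mulnA leq_mul2l; apply/orP; right.
  by apply: leq_trans q1 _; rewrite mulnA.
have : (2 * D2 + 1) * t <= K * t by rewrite leq_mul2r; apply/orP; right; rewrite /K; lia.
lia.
Qed.

Unset Implicit Arguments.

Theorem theorem1p3 (Delta m2 : nat) (hDelta : 0 < Delta) (hm2 : 0 < m2) :
  exists n2 : nat, forall n : nat, n2 <= n ->
    forall (V : finType) (e : rel V),
      is_tree e -> #|V| = n -> max_degree e <= Delta ->
      ~ has_bare_path e m2 ->
      maker_wins_within (complete_edges n) (tree_copies e n) (n + 1).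
Proof.
have [K [n0 const]] := scale_exists (Delta.+2 * (m2.+1 * Delta.+1 ^ m2)) hDelta.
exists n0 => n nn0 V e tree cV maxD nobare.
have [tau [[K0 n10 nK K_tau] [few_heavy bigL n_tau bign bigQ]]] := const n nn0.
have degD x : degree e x <= Delta by apply: leq_trans maxD; apply: leq_bigmax.
have [[e_sym _] _ _] := tree.
have /card_gt0P[r0 _] : 0 < #|V| by rewrite cV; lia.
have [par0 [d0 rt0]] := rooting r0 tree.
have [|c1 [c2 [Q [[e12 c1Q c2Q] [crossQ cQ cCQ]]]]] := balanced_edge e_sym rt0 degD.
  by rewrite cV; lia.
have [par [d rt]] := rooting c1 tree.
have [c21 pc2] : c2 != c1 /\ par c2 = c1.
  by case: (edge_par rt e12) => -[H ?] //; rewrite eqxx in H.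
have V1 : 1 < #|V| by rewrite cV; lia.
rewrite cV in cQ cCQ.
apply: (@wins_maker_wins_within _ _ _ set0); first exact: card_complete_edges.
rewrite addn1; right=> b bb.
have [|i [j [ij ijb]]] := @other_edge n b; first by lia.
have b2 : #|b| = 2 by apply/eqP; move: bb; rewrite inE.
exists [set i; j]; split; first by rewrite in_board.
  by rewrite in_setU1 negb_or ijb inE.
pose f x := if x == c1 then i else j; pose S : {set V} := [set c1; c2].
have fc2 : f c2 = j by rewrite /f (negbTE c21).
have fc1 : f c1 = i by rewrite /f eqxx.
have cS : #|S| = 2 by rewrite cards2 eq_sym c21.
have cSC := cardsC S.
have nS : #|~: S| + 2 = n by lia.
rewrite -[X in wins _ _ X]nS setU0.
apply: (controlled_win e_sym rt degD cV hm2 nobare c2Q c1Q crossQ _ _ few_heavy (bigL _ _)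
  n_tau K0 nK K_tau bign (f := f)).
- exact: bigQ cQ.
- by apply: bigQ; apply: leq_trans cCQ (leq_trans _ (leq_addr _ _)); rewrite leq_mul2l leq_pmull.
- by rewrite -cV; apply: (card_leaves e_sym rt degD hm2 nobare V1).
- split.
  + split.
    * split=> [|x]; first by rewrite !inE eqxx.
      by rewrite !inE => /orP[] /eqP->; rewrite ?(par_root rt) ?pc2 eqxx.
    * move=> x y /set2P[] -> /set2P[] -> //; rewrite fc1 fc2 => E; by rewrite E eqxx in ij.
    move=> x /set2P[] -> xr; first by rewrite eqxx in xr.
    by rewrite pc2 fc1 fc2 setUC setU11.
  + by rewrite sub1set.
  + move=> z _.
    have : edeg [set b] z <= 1.
      by rewrite -(cards1 b); apply/subset_leq_card/subsetP => c; rewrite inE => /andP[].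
    have tau0 : 0 < tau by have := few_heavy 1; have := bign; clear -n10; lia.
    by move=> /leq_trans; apply; rewrite addn0 (leq_trans tau0) ?leq_addr.
  right; apply: (@leq_trans #|[set c2]|); last by rewrite cards1.
  apply/subset_leq_card/subsetP => x /setIP[/set2P[]-> //]; last by rewrite inE.
  by move=> /leaves_leaf; rewrite /leaf eqxx.
- by rewrite !inE eqxx orbT.
- by rewrite cards1 cS.
clear -bign cSC cS nS; lia.
Qed.
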